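(* For every integer $d \geq 3$ and every $\varepsilon > 0$, there exist numbers $c,\delta > 0$ and a graph $G$ satisfying: 1. $G$ has uniform polynomial growth of degree $k$ for some $k \leq d+\varepsilon$. 2. $G$ is uniformly sphere-packed in $\mathbb{R}^d$. 3. For every $x \in V(G)$ and all integers $R' > R \geq 1$, there are at least $c R^{(d-1)+\delta}$ pairwise vertex-disjoint paths in $G$ from $S_G(x,R)$ to $S_G(x,R')$.
   Context: Graphs are connected and undirected (here possibly infinite), equipped with the path metric $d_G$. Write $B_G(x,R) = \{y \in V(G) : d_G(x,y) \leq R\}$ and $S_G(x,R) = \{y \in V(G) : d_G(x,y) = R\}$. A graph $G$ has uniform polynomial growth of degree $k$ (where $k \geq 1$) if there is a number $C \geq 1$ such that $C^{-1} R^k \leq |B_G(x,R)| \leq C R^k$ for all $x \in V(G)$ and all $R \geq 1$. A graph $G$ is sphere-packed in $\mathbb{R}^d$ if $G$ is the tangency graph of a collection of interior-disjoint spheres in $\mathbb{R}^d$ (the vertices are the spheres, which bound balls with pairwise disjoint interiors, and two spheres are adjacent exactly when they are tangent). It is $M$-uniformly sphere-packed in $\mathbb{R}^d$ if the collection can be chosen so that the ratio of the radii of any two tangent spheres lies in $[M^{-1},M]$, and it is uniformly sphere-packed in $\mathbb{R}^d$ if this holds for some $M<\infty$. *)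

(* Defs.v *)
From HB Require Import structures.
From mathcomp Require Import all_boot all_order all_algebra finmap.
From mathcomp Require Import all_classical all_reals all_analysis.

Set Implicit Arguments.
Unset Strict Implicit.
Unset Printing Implicit Defensive.

Import Order.TTheory GRing.Theory Num.Theory.

Local Open Scope classical_set_scope.
Local Open Scope ring_scope.

Record graph := Graph {
  vertex :> choiceType;
  adj : rel vertex;
  adj_sym : symmetric adj;
  adj_irr : irreflexive adj;
  graph_nonempty : inhabited vertex;
  graph_connected : forall x y : vertex, exists2 p, path adj x p & last x p = y }.

Section PathMetric.
Variable G : graph.
Implicit Types (x y : G) (n : nat).

Definition has_walk x y : pred nat :=
  fun n => `[< exists p, [/\ size p = n, path (@adj G) x p & last x p = y] >].

Lemma has_walk_ex x y : exists n, has_walk x y n.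
Proof.
by have [p xp py] := graph_connected x y; exists (size p); apply/asboolP; exists p.
Qed.

Definition gdist x y : nat := ex_minn (has_walk_ex x y).

Definition gball (R : realType) x (r : R) : set G :=
  [set y | (gdist x y)%:R <= r].

Definition gsphere x n : set G := [set y | gdist x y = n].

(* s is the list of all vertices of the path, both endpoints included *)
Definition path_between (A B : set G) (s : seq G) : Prop :=
  exists x p, [/\ s = x :: p, path (@adj G) x p, uniq s, A x & B (last x p)].

Definition disjoint_paths (A B : set G) n (P : 'I_n -> seq G) : Prop :=
  (forall i, path_between A B (P i)) /\
  trivIset [set: 'I_n] (fun i => [set` P i]).

End PathMetric.

(* fset_set is only meaningful on finite sets, hence the finite_set conjunct *)
Definition uniform_polynomial_growth (R : realType) (G : graph) (k : R) : Prop :=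
  1 <= k /\
  exists2 C : R, 1 <= C &
    forall (x : G) (r : R), 1 <= r ->
      [/\ finite_set (gball x r),
          C^-1 * r `^ k <= (#|` fset_set (gball x r)|)%:R &
          (#|` fset_set (gball x r)|)%:R <= C * r `^ k].

Section SpherePacking.
Variables (R : realType) (d : nat).
Implicit Types (u v : 'rV[R]_d) (r : R).

(* The norm that the library puts on 'rV[R]_d is the sup norm, not this one. *)
Definition edist u v : R := Num.sqrt (\sum_(i < d) (u 0 i - v 0 i) ^+ 2).

Definition open_eball u r : set 'rV[R]_d := [set v | edist u v < r].

Definition esphere u r : set 'rV[R]_d := [set v | edist u v = r].

(* For spheres bounding balls with disjoint interiors, tangency means having
   exactly one common point. *)
Definition tangent u r v s : Prop :=
  exists p, esphere u r `&` esphere v s = [set p].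

(* Spheres are indexed by the vertices; disjointness of the interiors makes the
   indexing injective. *)
Definition sphere_packing (G : graph) (c : G -> 'rV[R]_d) (rad : G -> R) : Prop :=
  [/\ forall x, 0 < rad x,
      forall x y, x <> y ->
        open_eball (c x) (rad x) `&` open_eball (c y) (rad y) = set0 &
      forall x y, adj x y <-> x <> y /\ tangent (c x) (rad x) (c y) (rad y)].

Definition M_uniformly_sphere_packed (M : R) (G : graph) : Prop :=
  exists (c : G -> 'rV[R]_d) (rad : G -> R), sphere_packing c rad /\
    forall x y : G, tangent (c x) (rad x) (c y) (rad y) ->
      M^-1 <= rad x / rad y <= M.

Definition uniformly_sphere_packed (G : graph) : Prop :=
  exists M : R, M_uniformly_sphere_packed M G.

End SpherePacking.
Arguments M_uniformly_sphere_packed {R} d M G.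
Arguments uniformly_sphere_packed R d G : clear implicits.

(* Main.v *)
Require Import Defs.
From mathcomp Require Import all_boot all_order all_algebra finmap.
From mathcomp Require Import all_classical all_reals all_analysis.
From mathcomp Require Import zify ring lra.

Set Implicit Arguments.
Unset Strict Implicit.
Unset Printing Implicit Defensive.

Import Order.TTheory GRing.Theory Num.Theory.

(** The graph is the tangency graph of the balls inscribed in the cubes of a
    self-similar tiling of part of R^(b+1), where d = b+1 and b >= 2.

    The tiling is made of columns over a tiling of the base R^b.  For the
    base, cut a cube into m^b equal cells and cut one cell, away from the
    boundary, once more into 3^b; substitute this pattern into each of its own
    cells n times and magnify by m^n.  Over a base tile of side s stands the
    stack of the cubes of side s.  As n grows these patterns extend one another
    to an infinite tiling in which the cubes are grouped, at every level n, into
    blocks that are all similar to each other.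

    The pattern has only equal cells along its boundary, so touching tiles have
    sides of ratio 1 or 3 (tile_near_scale), which gives the uniform packing.
    Ratio 3 rather than 2 makes the inscribed balls of cells of different sizes
    touch: the ball of the large cell meets the face between them at the centre
    of the middle small cell (hop_tangent).

    A block of level n contains N^n cubes with N = m (m^b - 1 + 3^(b+1)).
    Its graph diameter is of order m^n: every cube is close to a sub-block
    corner, and corners of sub-blocks are joined along block faces, where the
    cells are large (reach_block).  Here b >= 2 matters, because faces of a
    one-dimensional pattern are points.  Conversely a walk of length below m^n/9
    that starts in a block only meets the boundedly many neighbouring blocks,
    since all their cubes are small compared with the block (walk_halo).  Hence
    balls of radius r have about r^k cubes, with k = log N / log m, and k is at
    most d + eps once m is large.

    A block of level n stands over M^n base tiles with M = m^b - 1 + 3^b > m^b,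
    and the columns over them are disjoint infinite rays; each starts close to
    any given cube of the block and leaves every ball, so it crosses every larger
    sphere (columns, ray_path).  This gives about r^(log M / log m) disjoint
    paths, and log M / log m > b = d - 1. *)

(** * The self-similar tiling of the base *)

Section Tiling.
Local Open Scope nat_scope.
Variables b m : nat.

(** The tile (j, a) is the cube of side 3^-j with lower corner 3^-j * a. *)
Definition tile := (nat * {ffun 'I_b -> nat})%type.
Implicit Types (t f g h : tile) (n : nat).

(** The pattern of level n has side m^n.  Putting a copy of it into the tile t
    magnified by m^n sends the tile f of the pattern to place n t f. *)
Definition place n t f : tile :=
  (t.1 + f.1, [ffun i => f.2 i + 3 ^ f.1 * m ^ n * t.2 i]).

(** The grid of side m, with the cell (1, .., 1) cut into 3^b cells.  The
    coordinates of these small cells count thirds, so they start at 3. *)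
Definition seed : seq tile :=
  [seq (0, [ffun i => val (o i)]) | o : {ffun 'I_b -> 'I_m} <-
     enum [pred o : {ffun 'I_b -> 'I_m} | [exists i, val (o i) != 1]]] ++
  [seq (1, [ffun i => 3 + o i]) | o : {ffun 'I_b -> 'I_3} <- enum {ffun 'I_b -> 'I_3}].

Fixpoint tiling n : seq tile :=
  if n is n'.+1 then [seq place n' t f | t <- seed, f <- tiling n']
  else [:: (0, [ffun=> 0])].

Lemma mem_seed t : t \in seed ->
  [/\ t.1 = 0, forall i : 'I_b, t.2 i < m & exists i : 'I_b, t.2 i != 1] \/
  (t.1 = 1 /\ forall i : 'I_b, 3 <= t.2 i < 6).
Proof.
rewrite mem_cat => /orP[] /mapP[ o om ->] /=; [left|right].
- move: om; rewrite mem_enum inE => /existsP[i oi]; split=> //.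
  + by move=> k; rewrite ffunE.
  + by exists i; rewrite ffunE.
- by split=> // i; rewrite ffunE leq_addr /= -[6]/(3 + 3) ltn_add2l.
Qed.

Lemma seed_coarse (o : {ffun 'I_b -> nat}) :
  (forall i : 'I_b, o i < m) -> (exists i : 'I_b, o i != 1) -> (0, o) \in seed.
Proof.
move=> om [i oi]; rewrite mem_cat; apply/orP; left.
apply/mapP; exists [ffun k => Ordinal (om k)].
- by rewrite mem_enum inE; apply/existsP; exists i; rewrite ffunE.
- by congr pair; apply/ffunP=> k; rewrite !ffunE.
Qed.

Lemma seed_fine (o : {ffun 'I_b -> nat}) :
  (forall i : 'I_b, 3 <= o i < 6) -> (1, o) \in seed.
Proof.
move=> om; rewrite mem_cat; apply/orP; right.
have om' i : o i - 3 < 3 by have := om i; lia.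
apply/mapP; exists [ffun k => Ordinal (om' k)]; first by rewrite mem_enum.
by congr pair; apply/ffunP=> k; rewrite !ffunE /= subnKC //; case/andP: (om k).
Qed.

Lemma seed_uniq : uniq seed.
Proof.
rewrite cat_uniq; apply/and3P; split.
- rewrite map_inj_uniq ?enum_uniq // => o1 o2 [] /ffunP e; apply/ffunP=> i.
  by have := e i; rewrite !ffunE => /val_inj.
- by apply/hasPn=> t /mapP[ o _ ->]; apply/mapP=> -[].
- rewrite map_inj_uniq ?enum_uniq // => o1 o2 [] /ffunP e; apply/ffunP=> i.
  by have := e i; rewrite !ffunE => /addnI/val_inj.
Qed.

Lemma tilingS n f : f \in tiling n.+1 ->
  exists t g : tile, [/\ t \in seed, g \in tiling n & f = place n t g].
Proof. by move=> /allpairsP[[t g] /= [ts gs ->]]; exists t, g. Qed.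

Hypothesis m_ge4 : 4 <= m.

Lemma expm_gt0 n : 0 < m ^ n.
Proof. by rewrite expn_gt0 (leq_trans _ m_ge4). Qed.

Lemma size_seed : size seed = m ^ b - 1 + 3 ^ b.
Proof.
have m1 : 1 < m by apply: leq_trans m_ge4.
rewrite size_cat !size_map -enumT -!cardE card_ffun !card_ord; congr (_ + _).
rewrite -[in RHS](card_ord m) -[X in _ ^ X](card_ord b) -card_ffun.
have -> : #|{ffun 'I_b -> 'I_m}| = #|predC1 [ffun _ : 'I_b => Ordinal m1]|.+1.
  by rewrite cardC1 prednK // card_ffun !card_ord expn_gt0 (ltnW m1).
rewrite subSS subn0; apply: eq_card => o; rewrite !inE.
apply/existsP/idP => [[i oi]|]; first by apply: contraNneq oi => ->; rewrite ffunE.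
move=> ne; apply/existsP; rewrite -[X in is_true X]negbK negb_exists.
apply: contraNN ne => /forallP h; apply/eqP/ffunP=> i; apply/val_inj.
by rewrite ffunE /=; apply/eqP/negPn/h.
Qed.

Lemma sum_seed : \sum_(t <- seed) 3 ^ t.1 = m ^ b - 1 + 3 * 3 ^ b.
Proof.
have := size_seed; rewrite size_cat !size_map -enumT -!cardE card_ffun !card_ord.
move/addIn => <-; rewrite big_cat !big_map /=; congr (_ + _).
  by rewrite expn0 sum1_size -cardE.
rewrite expn1 big_const_seq count_predT iter_addn_0 -enumT -cardE.
by rewrite card_ffun !card_ord.
Qed.

Lemma seed_scale t : t \in seed -> t.1 <= 1.
Proof. by case/mem_seed => [[->]|[->]]. Qed.

Lemma seed_lt t (i : 'I_b) : t \in seed -> t.2 i < 3 ^ t.1 * m.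
Proof.
case/mem_seed => [[-> h _]|[-> h]]; first by rewrite expn0 mul1n.
by have := h i; lia.
Qed.

Lemma tiling_lt n f (i : 'I_b) : f \in tiling n -> f.2 i < 3 ^ f.1 * m ^ n.
Proof.
elim: n f => [|n IH] f; first by rewrite inE => /eqP ->; rewrite ffunE.
move=> /tilingS[t [g [ts gs ->]]]; rewrite /= ffunE expnD expnS.
have := IH _ gs; have := seed_lt i ts; nia.
Qed.

(** The inequality 3^-j (a+1) <= 3^-j' a', cleared of denominators. *)
Definition below f g (i : 'I_b) := (f.2 i).+1 * 3 ^ g.1 <= g.2 i * 3 ^ f.1.

Lemma below_neq f g (i : 'I_b) : below f g i -> f <> g.
Proof. by move=> + e; rewrite /below e leq_pmul2r ?expn_gt0 // ltnn. Qed.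

Lemma seed_below t t' : t \in seed -> t' \in seed -> t <> t' ->
  exists i : 'I_b, below t t' i \/ below t' t i.
Proof.
case: t t' => [e o] [e' o'] ts ts' ne.
have [eqe|nee] := eqVneq e e'.
  rewrite /below /= -{}eqe in ts' ne *.
  have /existsP[i oi] : [exists i, o i != o' i].
    rewrite -negb_forall; apply/negP=> /forallP h; apply: ne; congr pair.
    by apply/ffunP=> i; apply/eqP.
  exists i; rewrite !leq_pmul2r ?expn_gt0 //.
  by move: oi; rewrite neq_ltn => /orP[]; [left|right].
wlog e01 : e e' o o' ts ts' ne nee / e = 0 /\ e' = 1.
  move=> W; have := seed_scale ts; have := seed_scale ts'; rewrite /=.
  have [e0|e1] := eqVneq e 0; first by move=> *; apply: W => //; lia.
  move=> e'1 e1'; have [||i h] := W e' e o' o ts' ts (nesym ne).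
  - by rewrite eq_sym.
  - by move: nee e1; lia.
  - by exists i; case: h; [right|left].
case: e01 ts ts' => -> -> /mem_seed[[_ _ /= [i oi]]|[//]] /mem_seed[[//]|[_ /= oi']].
by exists i; rewrite /below /= expn0 expn1; have := oi' i; lia.
Qed.

Lemma place_below n t t' f f' (i : 'I_b) : f \in tiling n -> f' \in tiling n ->
  below t t' i -> below (place n t f) (place n t' f') i.
Proof.
move=> /(tiling_lt i) + /(tiling_lt i); rewrite /below /= !ffunE !expnD.
move: (3 ^ t.1) (3 ^ t'.1) (3 ^ f.1) (3 ^ f'.1) (m ^ n) => E E' J J' M.
move: (f.2 i) (f'.2 i) (t.2 i) (t'.2 i) => v v' o o' vlt v'lt h.
have h1 : (v + J * M * o).+1 <= J * M * o.+1 by nia.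
have := leq_mul h1 (leqnn (E' * J')).
have := leq_mul (leqnn (J * J' * M)) h.
nia.
Qed.

Lemma place_below2 n t f f' (i : 'I_b) :
  below f f' i -> below (place n t f) (place n t f') i.
Proof.
rewrite /below /= !ffunE !expnD.
move: (3 ^ t.1) (3 ^ f.1) (3 ^ f'.1) (m ^ n) => E J J' M.
move: (f.2 i) (f'.2 i) (t.2 i) => v v' o h.
have := leq_mul (leqnn E) h; nia.
Qed.

Lemma tiling_below n f f' : f \in tiling n -> f' \in tiling n -> f <> f' ->
  exists i : 'I_b, below f f' i \/ below f' f i.
Proof.
elim: n f f' => [|n IH] f f'.
  by rewrite !inE => /eqP-> /eqP->.
move=> /tilingS[t [g [ts gs ->]]] /tilingS[t' [g' [ts' gs' ->]]] ne.
have [eqt|net] := eqVneq t t'.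
  have [|i h] := IH _ _ gs gs'; first by move=> e; apply: ne; rewrite e eqt.
  by exists i; rewrite eqt; case: h => h; [left|right]; exact: place_below2.
have [i h] := seed_below ts ts' (elimN eqP net).
by exists i; case: h => h; [left|right]; exact: place_below.
Qed.

Lemma tiling_uniq n : uniq (tiling n).
Proof.
elim: n => //= n IH; apply: allpairs_uniq => //; first exact: seed_uniq.
move=> [? ?] [? ?] /allpairsP[[t f] /= [ts fs [-> ->]]].
move=> /allpairsP[[t' f'] /= [ts' fs' [-> ->]]] /= e.
have [eqt|/eqP net] := eqVneq t t'; last first.
  have [i [] /(place_below _ _) h] := seed_below ts ts' net; last first.
    by have /below_neq := h _ _ _ fs' fs; rewrite e.
  by have /below_neq := h _ _ _ fs fs'; rewrite e.
rewrite -{}eqt in ts' e *; have [->//|/eqP nef] := eqVneq f f'.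
by have [i [] /(@place_below2 n t)/below_neq] := tiling_below fs fs' nef; rewrite e.
Qed.

Lemma size_tiling n : size (tiling n) = (m ^ b - 1 + 3 ^ b) ^ n.
Proof.
by elim: n => //= n IH; rewrite size_allpairs IH size_seed expnS.
Qed.

Lemma sum_tiling n :
  \sum_(f <- tiling n) 3 ^ f.1 * m ^ n = (m * (m ^ b - 1 + 3 * 3 ^ b)) ^ n.
Proof.
elim: n => [|n IH]; first by rewrite big_seq1.
rewrite [RHS]expnS -{}IH -sum_seed /= big_allpairs_dep -mulnA big_distrl big_distrr /=.
apply: eq_bigr => t _; rewrite 2!big_distrr; apply: eq_bigr => f _.
by rewrite /= expnD expnS; ring.
Qed.

(** The cut cell is interior to the grid, so all cells along a face of the
    pattern are of the largest size, at every level.  A tile starting at distance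
    less than 1 from the face can therefore not be small. *)
Lemma low_face n f (i : 'I_b) : f \in tiling n -> f.2 i < 3 ^ f.1 -> f.1 = 0.
Proof.
elim: n f => [|n IH] f; first by rewrite inE => /eqP ->.
move=> /tilingS[t [g [ts gs ->]]]; rewrite /= ffunE expnD.
have M := expm_gt0 n.
have := IH _ gs; case/mem_seed: ts => [[-> _ _]|[-> oi]].
  have [->|o0] := posnP (t.2 i); first by rewrite muln0 addn0 mul1n.
  nia.
have Mo : 3 <= m ^ n * t.2 i.
  by case/andP: (oi i) => o3 _; apply: leq_trans o3 (leq_pmull _ M).
have := leq_mul (leqnn (3 ^ g.1)) Mo.
rewrite mulnA expn1; move: (3 ^ g.1) (m ^ n) => J M'; lia.
Qed.

Lemma high_face n f (i : 'I_b) :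
  f \in tiling n -> 3 ^ f.1 * m ^ n < (f.2 i).+1 + 3 ^ f.1 -> f.1 = 0.
Proof.
elim: n f => [|n IH] f; first by rewrite inE => /eqP ->.
move=> /tilingS[t [g [ts gs ->]]]; rewrite /= ffunE expnD expnS.
have M := expm_gt0 n.
have := IH _ gs; have := tiling_lt i gs.
have : 0 < 3 ^ g.1 by rewrite expn_gt0.
move: (3 ^ g.1) (m ^ n) M => J M M0 J0 vlt; case/mem_seed: ts => [[-> om _]|[-> oi]].
  have [e|o0] := eqVneq (t.2 i).+1 m; last by have := om i; nia.
  by rewrite -e; move=> h lt; apply: h; nia.
by have := oi i; nia.
Qed.

(** In every coordinate the gap between f and g is less than a third of the side of
    f.  The slack beyond plain contact is what walk_halo needs. *)
Definition tile_near f g := forall i : 'I_b,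
  3 * f.2 i * 3 ^ g.1 < 3 * (g.2 i).+1 * 3 ^ f.1 + 3 ^ g.1 /\
  3 * g.2 i * 3 ^ f.1 < 3 * (f.2 i).+1 * 3 ^ g.1 + 3 ^ g.1.

(** Two tiles in different cells of the grid are separated in some coordinate.
    If one of them were not of the largest size in its cell, it would keep clear
    of the face of that cell by the size of the largest tiles there, which is at
    least a third of the side of f, so that f and g would not be near.  Hence both
    have the scale of their cells, 0 or 1. *)
Lemma tile_near_scale n f g : f \in tiling n -> g \in tiling n -> tile_near f g ->
  f.1 <= g.1.+1 /\ g.1 <= f.1.+1.
Proof.
elim: n f g => [|n IH] f g; first by rewrite !inE => /eqP-> /eqP->.
move=> /tilingS[t [v [ts vs ->]]] /tilingS[t' [v' [ts' vs' ->]]] nr.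
have J0 : 0 < 3 ^ v.1 by rewrite expn_gt0.
have J0' : 0 < 3 ^ v'.1 by rewrite expn_gt0.
have [eqt|net] := eqVneq t t'.
  rewrite eqt -!addnS !leq_add2l; apply: (IH _ _ vs vs') => i.
  have := nr i; rewrite /= !ffunE !expnD {}eqt.
  have : 0 < 3 ^ t'.1 by rewrite expn_gt0.
  move: (3 ^ t'.1) (3 ^ v.1) (3 ^ v'.1) (m ^ n) J0 J0' (v.2 i) (v'.2 i) (t'.2 i).
  move=> E J J' M J0 J0' a a' o E0 [h1 h2]; split.
    rewrite -(ltn_pmul2l E0) -(ltn_add2r (3 * (J * M * o) * (E * J'))).
    by move: h1; congr (_ < _); ring.
  rewrite -(ltn_pmul2l E0) -(ltn_add2r (3 * (J * M * o) * (E * J'))).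
  by move: h2; congr (_ < _); ring.
suff [j0 j0'] : v.1 = 0 /\ v'.1 = 0.
  rewrite /= j0 j0' !addn0; have := seed_scale ts; have := seed_scale ts'; lia.
have [i sep] := seed_below ts ts' (elimN eqP net).
have := nr i; rewrite /= !ffunE !expnD.
have := low_face (i := i) vs; have := low_face (i := i) vs'.
have := high_face (i := i) vs; have := high_face (i := i) vs'.
have := tiling_lt i vs; have := tiling_lt i vs'.
have E3 : 3 ^ t.1 <= 3 ^ 1 by rewrite leq_exp2l ?seed_scale.
have E3' : 3 ^ t'.1 <= 3 ^ 1 by rewrite leq_exp2l ?seed_scale.
have E0 : 0 < 3 ^ t.1 by rewrite expn_gt0.
have E0' : 0 < 3 ^ t'.1 by rewrite expn_gt0.
move: sep J0 J0' E3 E3' E0 E0'; rewrite /below.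
move: (3 ^ t.1) (3 ^ t'.1) (3 ^ v.1) (3 ^ v'.1) (m ^ n).
move: (v.2 i) (v'.2 i) (t.2 i) (t'.2 i).
move=> a a' o o' E E' J J' M sep J0 J0' E3 E3' E0 E0' lt' lt hi' hi lo' lo [h1 h2].
have JJ : 0 < J * J' by rewrite muln_gt0 J0.
case: sep => sep.
- (* the cell of f lies below the cell of g in the coordinate i, so f is at the
     top of its cell and g at the bottom of its own *)
  have key : J * J' * M * (o.+1 * E') <= J * J' * M * (o' * E) by rewrite leq_mul.
  have JJE : J * J' <= J * J' * E by rewrite leq_pmulr.
  have JJE' : J' * E' <= J * (J' * E') by rewrite leq_pmull.
  split.
    apply: hi; rewrite ltnNge; apply/negP => h.
    have : (a + J * M * o).+1 + J <= J * M * o.+1 by nia.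
    move/(leq_mul (leqnn (3 * (E' * J')))); nia.
  apply: lo'; rewrite ltnNge; apply/negP => h.
  have : (a + J * M * o).+1 <= J * M * o.+1 by nia.
  move/(leq_mul (leqnn (3 * (E' * J')))).
  have : 3 * (J' * (E * J)) <= 3 * (a' * (E * J)) by rewrite !leq_mul.
  have : E' * J' <= 3 * J' by rewrite leq_mul.
  nia.
have key : J * J' * M * (o'.+1 * E) <= J * J' * M * (o * E') by rewrite leq_mul.
have JJE : J * J' <= J * J' * E by rewrite leq_pmulr.
have JJE' : J' * E' <= J * (J' * E') by rewrite leq_pmull.
have EJ' : E' * J' <= 3 * J' by rewrite leq_mul.
split.
  apply: lo; rewrite ltnNge; apply/negP => h.
  have : (a' + J' * M * o').+1 <= J' * M * o'.+1 by nia.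
  move/(leq_mul (leqnn (3 * (E * J)))).
  have : 3 * (J * (E' * J')) <= 3 * (a * (E' * J')) by rewrite !leq_mul.
  nia.
apply: hi'; rewrite ltnNge; apply/negP => h.
have : (a' + J' * M * o').+1 + J' <= J' * M * o'.+1 by nia.
move/(leq_mul (leqnn (3 * (E * J)))); nia.
Qed.

Lemma place_assoc n k t g h :
  place (n + k) t (place n g h) = place n (place k t g) h.
Proof.
rewrite /place /=; congr pair; first by rewrite addnA.
by apply/ffunP=> i; rewrite !ffunE !expnD; ring.
Qed.

Lemma place0 k g : place k g (0, [ffun=> 0]) = (g.1, [ffun i => m ^ k * g.2 i]).
Proof.
by rewrite /place addn0; congr pair; apply/ffunP=> i; rewrite !ffunE mul1n.
Qed.

Lemma tilingD n k f : f \in tiling (n + k) ->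
  exists g h, [/\ g \in tiling k, h \in tiling n & f = place n g h].
Proof.
elim: k f => [|k IH] f.
  rewrite addn0 => fs; exists (0, [ffun=> 0]), f; split; rewrite ?inE //.
  rewrite /place add0n [LHS]surjective_pairing; congr pair.
  by apply/ffunP=> i; rewrite !ffunE muln0 addn0.
rewrite addnS => /tilingS[t [v [ts /IH[g [h [gs hs ->]]] ->]]].
exists (place k t g), h; split=> //; first by apply/allpairsP; exists (t, g).
by rewrite place_assoc.
Qed.

Lemma place_tiling n k g h :
  g \in tiling k -> h \in tiling n -> place n g h \in tiling (n + k).
Proof.
elim: k g => [|k IH] g gs hs.
  move: gs; rewrite inE => /eqP ->; rewrite addn0.
  suff -> : place n (0, [ffun=> 0]) h = h by [].
  rewrite /place add0n [RHS]surjective_pairing; congr pair.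
  by apply/ffunP=> i; rewrite !ffunE muln0 addn0.
move: gs => /tilingS[t [v [ts vs ->]]]; rewrite addnS.
by apply/allpairsP; exists (t, place n v h); rewrite place_assoc; split=> //; exact: IH.
Qed.

(** The expansion of x in base m with n digits avoids the digit 1, so a tile with
    this coordinate never lies in a cut cell. *)
Fixpoint no_digit1 n x :=
  if n is n'.+1 then (x %/ m ^ n' != 1) && no_digit1 n' (x %% m ^ n') else true.

Lemma no_digit1_0 n : no_digit1 n 0.
Proof. by elim: n => //= n IH; rewrite div0n mod0n IH. Qed.

Lemma no_digit1_max n : no_digit1 n (m ^ n).-1.
Proof.
elim: n => //= n IH; have M := expm_gt0 n.
have -> : (m ^ n.+1).-1 = (m.-1) * m ^ n + (m ^ n).-1.
  by rewrite expnS; move: (m ^ n) M => k k0; nia.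
rewrite divnMDl // modnMDl divn_small ?modn_small ?IH; lia.
Qed.

(** The unit cells that survive all n subdivisions: a single coordinate without
    digit 1 suffices, which covers the faces of the pattern (no_digit1_0,
    no_digit1_max) and, for n = 1, all uncut cells of the grid. *)
Lemma coarse_tiling n (v : {ffun 'I_b -> nat}) :
  (forall i : 'I_b, v i < m ^ n) -> (exists i : 'I_b, no_digit1 n (v i)) ->
  (0, v) \in tiling n.
Proof.
elim: n v => [|n IH] v vlt [i vi].
  rewrite inE; apply/eqP; congr pair; apply/ffunP=> k; rewrite ffunE.
  by have := vlt k; rewrite expn0 ltnS leqn0 => /eqP.
have M := expm_gt0 n.
case/andP: vi => vi1 vi2.
apply/allpairsP; exists ((0, [ffun k => v k %/ m ^ n]), (0, [ffun k => v k %% m ^ n])).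
split=> /=.
- apply: seed_coarse => [k|]; last by exists i; rewrite ffunE.
  by rewrite ffunE ltn_divLR // -expnS.
- apply: IH => [k|]; last by exists i; rewrite ffunE.
  by rewrite ffunE ltn_mod.
- congr pair; apply/ffunP=> k; rewrite !ffunE /= expn0 mul1n mulnC addnC.
  by rewrite -divn_eq.
Qed.

Hypothesis b_gt0 : 0 < b.

Lemma tiling_mono n k : n <= k -> {subset tiling n <= tiling k}.
Proof.
move=> /subnKC <-; elim: (k - n) => [|l IH] f fs; first by rewrite addn0.
rewrite addnS; apply/allpairsP; exists ((0, [ffun=> 0]), f); split=> /=.
- apply: seed_coarse => [i|]; first by rewrite ffunE; lia.
  by exists (Ordinal b_gt0); rewrite ffunE.
- exact: IH.
- rewrite /place add0n [LHS]surjective_pairing; congr pair.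
  by apply/ffunP=> i; rewrite !ffunE muln0 addn0.
Qed.

End Tiling.

(** * Short walks inside a block *)

Section Walks.
Local Open Scope nat_scope.
Variables b m : nat.
Local Notation tile := (tile b).
Local Notation tiling := (@tiling b m).
Local Notation place := (@place b m).
Local Notation vertex := (tile * nat)%type.
Implicit Types (x y : tile * nat) (f g : tile) (i : 'I_b) (v : {ffun 'I_b -> nat}).

Definition in_tiling f := exists n, f \in tiling n.

(** A vertex (f, z) is the cube number z of the column over the tile f.  The
    three kinds of contact are: the next cube of the column, the next
    cube of the same size in a base direction, and the small cube
    centred on the upper face of x in the direction i. *)
Variant hop x y : Prop :=
| HopUp of x.1 = y.1 & y.2 = x.2.+1
| HopSide i of x.1.1 = y.1.1 & x.2 = y.2 &
    forall k, y.1.2 k = x.1.2 k + (k == i)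
| HopScale i of y.1.1 = x.1.1.+1 & y.2 = (3 * x.2).+1 &
    y.1.2 i = 3 * (x.1.2 i).+1 &
    forall k, k != i -> y.1.2 k = (3 * x.1.2 k).+1.

Inductive reach : nat -> vertex -> vertex -> Prop :=
| reach_refl l x : reach l x x
| reach_cons l x y z : in_tiling x.1 -> in_tiling y.1 ->
    (hop x y \/ hop y x) -> reach l y z -> reach l.+1 x z.

Lemma reach_le l l' x y : reach l x y -> l <= l' -> reach l' x y.
Proof.
move=> r; elim: r l' => [l1 x1|l1 x1 y1 z1 xH yH xy r IH] [|l'] // ll';
  try exact: reach_refl.
by apply: reach_cons xH yH xy _; apply: IH.
Qed.

Lemma reach_trans l1 l2 x y z : reach l1 x y -> reach l2 y z -> reach (l1 + l2) x z.
Proof.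
elim=> [l x1 r|l x1 y1 z1 xH yH xy _ IH r].
  by apply: reach_le r _; rewrite leq_addl.
by rewrite addSn; apply: reach_cons xH yH xy (IH r).
Qed.

Lemma reach1 x y : in_tiling x.1 -> in_tiling y.1 -> hop x y -> reach 1 x y.
Proof. by move=> xH yH xy; apply: reach_cons xH yH (or_introl xy) (reach_refl _ _). Qed.

Lemma reach_sym l x y : reach l x y -> reach l y x.
Proof.
elim=> [l1 x1|l1 x1 y1 z1 xH yH xy _ IH]; first exact: reach_refl.
rewrite -addn1; apply: reach_trans IH _.
by apply: reach_cons yH xH _ (reach_refl _ _); tauto.
Qed.

Lemma reach_up f z k : in_tiling f -> reach k (f, z) (f, z + k).
Proof.
move=> fH; elim: k => [|k IH]; first by rewrite addn0; exact: reach_refl.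
rewrite -addn1; apply: reach_trans IH _; rewrite addn1 addnS.
by apply: reach1 => //; exact: HopUp.
Qed.

Lemma reach_column f z z' l : in_tiling f -> z <= z' + l -> z' <= z + l ->
  reach l (f, z) (f, z').
Proof.
move=> fH h1 h2; have [zz'|z'z] := leqP z z'.
  rewrite -(subnKC zz'); apply: reach_le (reach_up _ _ fH) _; lia.
apply: reach_sym; rewrite -(subnKC (ltnW z'z)).
by apply: reach_le (reach_up _ _ fH) _; lia.
Qed.

Hypothesis m_ge4 : 4 <= m.
Hypothesis m_mod3 : m %% 3 = 1.
Hypothesis b_ge2 : 2 <= b.

Lemma other_index (i : 'I_b) : exists k : 'I_b, k != i.
Proof.
have b0 : 0 < b by apply: ltnW.
have [->|] := eqVneq i (Ordinal b0); first by exists (Ordinal b_ge2).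
by rewrite eq_sym; exists (Ordinal b0).
Qed.

Lemma in_tiling_place n g f : in_tiling g -> f \in tiling n -> in_tiling (place n g f).
Proof. by move=> [k gk] fn; exists (n + k); apply: place_tiling. Qed.

Definition decr (v : {ffun 'I_b -> nat}) i : {ffun 'I_b -> nat} :=
  [ffun k => v k - (k == i)].

Lemma sum_decr v i : 0 < v i -> \sum_k v k = (\sum_k decr v i k).+1.
Proof.
move=> vi; rewrite (bigD1 i) // (bigD1 i (P := xpredT)) //= !ffunE eqxx subn1.
rewrite -addSn prednK //; congr (_ + _); apply: eq_bigr => k ki.
by rewrite ffunE (negbTE ki) subn0.
Qed.

Lemma hop_decr n g v i z : 0 < v i ->
  hop (place n g (0, decr v i), z) (place n g (0, v), z).
Proof.
move=> vi; apply: (@HopSide _ _ i) => // k; rewrite /= !ffunE.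
by case: (eqVneq k i) => [->|_]; lia.
Qed.

(** Walk towards the corner one coordinate at a time.  A coordinate without digit
    1 keeps the walk on unit cells while the others decrease to 0; then one of
    those zeros takes over this role.  This is where two coordinates are needed. *)
Lemma reach_corner n g (v : {ffun 'I_b -> nat}) z : in_tiling g ->
  (forall i, v i < m ^ n) -> (exists i, no_digit1 m n (v i)) ->
  reach (\sum_i v i) (place n g (0, v), z) (place n g (0, [ffun=> 0]), z).
Proof.
move=> gH; move e : (\sum_i v i) => s; elim: s v e => [|s IH] v sv vlt [i vi].
  have -> : v = [ffun=> 0]; last exact: reach_refl.
  apply/ffunP=> k; rewrite ffunE; move/eqP: sv; rewrite sum_nat_eq0.
  by move=> /forallP/(_ k)/eqP.
suff [k vk [j]] : exists2 k, 0 < v k & exists j, no_digit1 m n (decr v k j).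
  move=> dj; have dlt l : decr v k l < m ^ n.
    by rewrite ffunE; apply: leq_ltn_trans (leq_subr _ _) (vlt l).
  apply: (@reach_cons s _ (place n g (0, decr v k), z)).
  - by apply: in_tiling_place => //; apply: (coarse_tiling m_ge4 vlt); exists i.
  - by apply: in_tiling_place => //; apply: (coarse_tiling m_ge4 dlt); exists j.
  - by right; exact: hop_decr.
  - by apply: IH => //; [move: sv; rewrite (sum_decr vk) => -[]|exists j].
have [/existsP[k /andP[ki vk]]|] := boolP [exists k, (k != i) && (0 < v k)].
  by exists k => //; exists i; rewrite ffunE eq_sym (negbTE ki) subn0.
rewrite negb_exists => /forallP nex.
have v0 k : k != i -> v k = 0.
  by move=> ki; have := nex k; rewrite ki lt0n negbK => /eqP.
have vi0 : 0 < v i.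
  by have : \sum_k v k = v i; [rewrite (bigD1 i) //= big1 ?addn0|rewrite sv => <-].
have [j ji] := other_index i.
by exists i => //; exists j; rewrite ffunE (v0 _ ji); exact: no_digit1_0.
Qed.

(** The cube at the lower corner of the level-n block x. *)
Definition corner n x : vertex := (place n x.1 (0, [ffun=> 0]), m ^ n * x.2).

Lemma tiling_origin n : (0, [ffun=> 0]) \in tiling n.
Proof.
apply: (coarse_tiling m_ge4) => [i|]; first by rewrite ffunE expm_gt0.
by exists (Ordinal b_ge2); rewrite ffunE no_digit1_0.
Qed.

Lemma sum_le_const (v : {ffun 'I_b -> nat}) l :
  (forall i, v i <= l) -> \sum_i v i <= b * l.
Proof.
move=> vl; apply: (@leq_trans (\sum_(i < b) l)); first exact: leq_sum.
by rewrite sum_nat_const card_ord.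
Qed.

Lemma expn_mod3 n : exists q, m ^ n = (3 * q).+1.
Proof.
exists (m ^ n %/ 3); rewrite {1}(divn_eq (m ^ n) 3) -modnXm m_mod3 exp1n mulnC.
by rewrite addn1.
Qed.

(** Contact of two blocks is realised by a walk between their corners of length
    proportional to their side.  When the sizes differ, the corner cube of the
    small block is itself centred on a face of a unit cell of the large
    block, because m = 1 mod 3; that cell lies on a face of its block, so
    reach_corner leads from it to the corner. *)
Lemma hop_corner n x y : in_tiling x.1 -> in_tiling y.1 -> hop x y ->
  reach (b.+1 * m ^ n) (corner n x) (corner n y).
Proof.
case: x y => [[e v] z] [[e' v'] z'] /= xH yH [] /=.
- move=> [ee vv] ->; rewrite /corner /= -ee -vv; apply: reach_column.
  + exact: in_tiling_place (tiling_origin n).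
  + by rewrite mulnS; lia.
  + by rewrite mulnS mulSn; lia.
- move=> i ee <- vv; rewrite /corner /= -{}ee in yH *.
  pose u : {ffun 'I_b -> nat} := [ffun k => (m ^ n).-1 * (k == i)].
  have M := expm_gt0 m_ge4 n.
  have ult k : u k < m ^ n by rewrite ffunE; case: eqP => _; rewrite ?muln1 ?muln0; lia.
  have [j ji] := other_index i.
  have uj : no_digit1 m n (u j) by rewrite ffunE (negbTE ji) muln0 no_digit1_0.
  have r1 : reach (b * m ^ n) (place n (e, v) (0, u), m ^ n * z)
      (place n (e, v) (0, [ffun=> 0]), m ^ n * z).
    apply: reach_le (reach_corner _ xH ult _) _; first by exists j.
    by apply: sum_le_const => k; apply: ltnW.
  rewrite mulSn addnC; apply: reach_trans (reach_sym r1) _.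
  apply: (@reach_le 1) => //; apply: reach1 => /=.
  + by apply: in_tiling_place => //; apply: (coarse_tiling m_ge4 ult); exists j.
  + exact: in_tiling_place (tiling_origin n).
  + apply: (@HopSide _ _ i) => // k; rewrite /= !ffunE vv /= !mul1n.
    by case: eqP => _; rewrite ?muln1 ?muln0; nia.
- move=> i ee -> vi vk; rewrite /corner /=.
  have M := expm_gt0 m_ge4 n; have [q mq] := expn_mod3 n.
  (* the unit cell of the large block below the corner of the small one: the
     lower corner of the middle third has offset q = (m^n - 1)/3 *)
  pose u : {ffun 'I_b -> nat} := [ffun k => if k == i then (m ^ n).-1 else q].
  have ult k : u k < m ^ n by rewrite ffunE; case: ifP => _; lia.
  have ui : no_digit1 m n (u i) by rewrite ffunE eqxx no_digit1_max.
  have uH : (0, u) \in tiling n by apply: (coarse_tiling m_ge4 ult); exists i.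
  have r1 : reach (b * (m ^ n).-1) (place n (e, v) (0, u), m ^ n * z)
      (place n (e, v) (0, [ffun=> 0]), m ^ n * z).
    apply: reach_le (reach_corner _ xH ult _) _; first by exists i.
    by apply: sum_le_const => k; have := ult k; lia.
  have r2 : reach q (place n (e, v) (0, u), m ^ n * z)
      (place n (e, v) (0, u), m ^ n * z + q).
    by apply: reach_up; apply: in_tiling_place.
  have r3 : reach 1 (place n (e, v) (0, u), m ^ n * z + q)
      (place n (e', v') (0, [ffun=> 0]), m ^ n * (3 * z).+1).
    apply: reach1; [exact: in_tiling_place|exact: in_tiling_place (tiling_origin n)|].
    apply: (@HopScale _ _ i); rewrite /= ?addn0 ?ffunE //=.
    + by rewrite mq; lia.
    + by rewrite eqxx vi mul1n; nia.
    + by move=> k ki; rewrite !ffunE (negbTE ki) vk // mul1n; nia.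
  apply: reach_le (reach_trans (reach_sym r1) (reach_trans r2 r3)) _.
  by rewrite mulSn; nia.
Qed.

Lemma corner_corner n k x : corner n (corner k x) = corner (n + k) x.
Proof.
rewrite /corner /= mulnA -expnD -place_assoc; congr (place _ _ _, _).
by rewrite place0; congr pair; apply/ffunP=> i; rewrite !ffunE muln0.
Qed.

Lemma reach_lift n l x y :
  reach l x y -> reach (l * (b.+1 * m ^ n)) (corner n x) (corner n y).
Proof.
elim=> [l1 x1|l1 x1 y1 z1 xH yH xy _ IH]; first exact: reach_refl.
rewrite mulSn; apply: reach_trans IH; case: xy => h; first exact: hop_corner.
by apply: reach_sym; exact: hop_corner.
Qed.

Lemma seed_tiling1 t : t \in seed b m -> t \in tiling 1.
Proof.
move=> ts; apply/allpairsP; exists (t, (0, [ffun=> 0])); split=> //.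
  by rewrite inE.
rewrite place0 [LHS]surjective_pairing; congr pair.
by apply/ffunP=> i; rewrite ffunE mul1n.
Qed.

Lemma in_tiling_fine g v : in_tiling g -> (forall i, 3 <= v i < 6) ->
  in_tiling (place 1 g (1, v)).
Proof. by move=> gH sv; apply: in_tiling_place gH (seed_tiling1 (seed_fine _ sv)). Qed.

Lemma reach_fine g v z : in_tiling g -> (forall i, 3 <= v i < 6) ->
  reach (2 * b) (place 1 g (1, v), z) (place 1 g (1, [ffun=> 3]), z).
Proof.
move=> gH sv; move e : (\sum_i (v i - 3)) => s.
have le : s <= b * 2.
  rewrite -e; have := @sum_le_const [ffun i => v i - 3] 2.
  under eq_bigr do rewrite ffunE.
  by apply=> i; rewrite ffunE; have := sv i; lia.
rewrite mulnC; apply: reach_le le.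
elim: s v e sv => [|s IH] v e sv.
  have -> : v = [ffun=> 3]; last exact: reach_refl.
  apply/ffunP=> k; rewrite ffunE; move/eqP: e; rewrite sum_nat_eq0.
  move=> /forallP/(_ k); rewrite /= subn_eq0 => vk.
  by apply/eqP; rewrite eqn_leq vk; case/andP: (sv k).
have [k vk] : exists k : 'I_b, 3 < v k.
  apply/existsP; rewrite -[X in is_true X]negbK negb_exists; apply/negP=> /forallP h.
  by move: e; rewrite big1 // => k _; have := h k; lia.
have dv i : 3 <= decr v k i < 6.
  by rewrite ffunE; have := sv i; case: eqVneq => [->|_]; lia.
apply: (@reach_cons s _ (place 1 g (1, decr v k), z)).
- exact: in_tiling_fine.
- exact: in_tiling_fine.
- right; apply: (@HopSide _ _ k) => // i; rewrite /= !ffunE.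
  by case: (eqVneq i k) => [->|_]; lia.
- apply: IH => //; move: e; rewrite (bigD1 k) //= => e.
  rewrite (bigD1 k) //= ffunE eqxx (eq_bigr (fun i => v i - 3)).
    by move: e; move: (\sum_(_ | _) _) => S; lia.
  by move=> i ik; rewrite ffunE (negbTE ik) subn0.
Qed.

(** Steps between neighbouring cubes that lead from any cell of the seed pattern to
    the corner: (b+1) m through uncut cells, and before that at most 4 b + 2 to
    leave the cut cell. *)
Definition block_radius1 := b.+1 * m + (4 * b).+2.

Lemma reach_corner1_coarse g v z w : in_tiling g ->
  (forall i, v i < m) -> (exists i, v i != 1) -> w < m ->
  reach (b.+1 * m) (place 1 g (0, v), w + m * z) (corner 1 (g, z)).
Proof.
move=> gH vm [i vi] wm; rewrite mulSn addnC /corner /= expn1.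
have vm' k : v k < m ^ 1 by rewrite expn1.
have vi' : no_digit1 m 1 (v i) by rewrite /= divn1 vi.
apply: (@reach_trans _ _ _ (place 1 g (0, [ffun=> 0]), w + m * z)).
  apply: reach_le (reach_corner _ gH vm' _) _; first by exists i.
  by apply: sum_le_const => k; apply: ltnW.
by apply: reach_column; [exact: in_tiling_place (tiling_origin 1)|lia|lia].
Qed.

(** Inside a cut cell, go to the small cube facing the neighbouring uncut cell
    whose coordinate 0 is 0, cross over, and use reach_corner there. *)
Lemma reach_corner1 g t z w : in_tiling g -> t \in seed b m -> w < 3 ^ t.1 * m ->
  reach block_radius1 (place 1 g t, w + 3 ^ t.1 * m * z) (corner 1 (g, z)).
Proof.
move=> gH; case: t => e v /mem_seed[] /= [-> ].
  move=> vm vi; rewrite expn0 mul1n => wm.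
  by apply: reach_le (reach_corner1_coarse z gH vm vi wm) _; rewrite leq_addr.
move=> sv; rewrite expn1 => wm.
pose i0 := Ordinal (ltnW b_ge2).
pose v' : {ffun 'I_b -> nat} := [ffun i => if i == i0 then 3 else 4].
pose u : {ffun 'I_b -> nat} := [ffun i => if i == i0 then 0 else 1].
have sv' i : 3 <= v' i < 6 by rewrite ffunE; case: ifP.
have um i : u i < m by rewrite ffunE; case: ifP => _; lia.
have ui : exists i, u i != 1 by exists i0; rewrite ffunE eqxx.
have uH : in_tiling (place 1 g (0, u)).
  by apply: in_tiling_place gH (seed_tiling1 (seed_coarse um ui)).
have r1 := reach_fine (w + 3 * m * z) gH sv.
have r2 := reach_fine (w + 3 * m * z) gH sv'.
pose q := w %/ 3; have qm : q < m by rewrite ltn_divLR //; lia.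
have r3 : reach 1 (place 1 g (1, v'), w + 3 * m * z)
                  (place 1 g (1, v'), (3 * (q + m * z)).+1).
  by apply: reach_column; [exact: in_tiling_fine| |]; rewrite /q; lia.
have r4 : reach 1 (place 1 g (0, u), q + m * z)
                  (place 1 g (1, v'), (3 * (q + m * z)).+1).
  apply: reach1 => //; first exact: in_tiling_fine.
  apply: (@HopScale _ _ i0); rewrite /= ?addn0 ?addn1 ?ffunE //=.
    by rewrite ?eqxx; lia.
  by move=> k ki; rewrite !ffunE (negbTE ki) /=; lia.
have r5 := reach_corner1_coarse z gH um ui qm.
have r := reach_trans r1 (reach_trans (reach_sym r2)
  (reach_trans r3 (reach_trans (reach_sym r4) r5))).
by apply: reach_le r _; rewrite /block_radius1; lia.
Qed.

Definition block_radius := block_radius1 * b.+1.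

(** Sum of a geometric series: from a cube to the corner of its block of level n,
    then by a bounded number of block contacts to the corner of the
    block of level n+1. *)
Lemma reach_block n g f z w : in_tiling g -> f \in tiling n ->
  w < 3 ^ f.1 * m ^ n ->
  reach (block_radius * (m ^ n).-1) (place n g f, w + 3 ^ f.1 * m ^ n * z)
    (corner n (g, z)).
Proof.
move=> + fn; elim: n f fn g z w => [|n IH] f fn g z w gH.
  move: fn; rewrite inE => /eqP ->; rewrite expn0 mul1n ltnS leqn0 => /eqP ->.
  by rewrite mul1n add0n /corner /= mul1n; exact: reach_refl.
have [t [h [ts hs ->]]] := tilingS fn; move=> wlt.
have M := expm_gt0 m_ge4 n; have J : 0 < 3 ^ h.1 by rewrite expn_gt0.
have H0 : 0 < 3 ^ h.1 * m ^ n by rewrite muln_gt0 J.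
pose w1 := w %% (3 ^ h.1 * m ^ n); pose w2 := w %/ (3 ^ h.1 * m ^ n).
have w2lt : w2 < 3 ^ t.1 * m.
  rewrite /w2 ltn_divLR //; move: wlt; rewrite /= expnD expnS.
  by congr (_ < _); ring.
have gt : in_tiling (place 1 g t) by apply: in_tiling_place gH (seed_tiling1 ts).
have r1 := IH _ hs _ (w2 + 3 ^ t.1 * m * z) w1 gt (ltn_pmod w H0).
have r2 := reach_lift n (reach_corner1 z gH ts w2lt).
rewrite corner_corner addn1 in r2.
rewrite -place_assoc addn1 in r1.
have -> : w + 3 ^ (place n t h).1 * m ^ n.+1 * z =
    w1 + 3 ^ h.1 * m ^ n * (w2 + 3 ^ t.1 * m * z).
  rewrite {1}(divn_eq w (3 ^ h.1 * m ^ n)) -/w1 -/w2 /= expnD expnS; ring.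
apply: reach_le (reach_trans r1 r2) _.
rewrite mulnA -/block_radius -mulnDr leq_mul2l expnS; apply/orP; right.
by move: M; case: (m ^ n) => // k _; nia.
Qed.

End Walks.

(** * Inscribed spheres *)

Section Spheres.
Local Open Scope ring_scope.
Variables (R : realType).

Lemma edist_coord d (u v : 'rV[R]_d) i : `|u 0 i - v 0 i| <= Defs.edist u v.
Proof.
rewrite -sqrtr_sqr ler_wsqrtr // (bigD1 i) //= lerDl sumr_ge0 // => k _.
exact: sqr_ge0.
Qed.

Lemma edist_axis d (u v : 'rV[R]_d) i :
  (forall k, k != i -> u 0 k = v 0 k) -> Defs.edist u v = `|u 0 i - v 0 i|.
Proof.
move=> uv; rewrite /Defs.edist (bigD1 i) //= big1 ?addr0 ?sqrtr_sqr // => k ki.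
by rewrite uv // subrr expr0n.
Qed.

Lemma tangentC d (u v : 'rV[R]_d) r s : tangent u r v s -> tangent v s u r.
Proof. by move=> [p]; rewrite setIC; exists p. Qed.

(** Subtracting the equations of the two spheres fixes the i-th coordinate of a
    common point; then either equation forces the other coordinates. *)
Lemma tangent_axis d (u v : 'rV[R]_d) r s i : 0 < r -> 0 < s ->
  (forall k, k != i -> u 0 k = v 0 k) -> v 0 i = u 0 i + r + s ->
  tangent u r v s.
Proof.
move=> r0 s0 uv vi.
pose p : 'rV[R]_d := \row_k (if k == i then u 0 i + r else u 0 k).
exists p; apply/seteqP; split=> [q [/= uq vq]|q ->]; last first.
  split; rewrite /esphere /= (edist_axis (i := i)).
  - by rewrite mxE eqxx opprD addrA subrr sub0r normrN gtr0_norm.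
  - by move=> k ki; rewrite mxE (negbTE ki).
  - by rewrite mxE eqxx vi addrAC subrr add0r gtr0_norm.
  - by move=> k ki; rewrite mxE (negbTE ki) uv.
have sq w t : 0 < t -> Defs.edist w q = t -> \sum_(k < d) (w 0 k - q 0 k) ^+ 2 = t ^+ 2.
  move=> t0 <-; rewrite sqr_sqrtr // sumr_ge0 // => k _; exact: sqr_ge0.
have := sq _ _ r0 uq; have := sq _ _ s0 vq.
rewrite (bigD1 i) //= [in X in _ -> X -> _](bigD1 i) //= vi.
rewrite (eq_bigr (fun k => (u 0 k - q 0 k) ^+ 2)); last first.
  by move=> k ki; rewrite uv.
set S := \sum_(k < d | _) _ => h1 h2.
have qi : q 0 i = u 0 i + r.
  have : (r + s) * (q 0 i - (u 0 i + r)) = 0 by nra.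
  by move/eqP; rewrite mulf_eq0 gt_eqF ?addr_gt0 //= subr_eq0 => /eqP.
have S0 : S = 0 by move: h2; rewrite qi; nra.
apply/rowP=> k; rewrite mxE; case: eqVneq => [->//|ki].
have /allP/(_ k) : all (fun k => (k != i) ==> ((u 0 k - q 0 k) ^+ 2 == 0))
    (index_enum 'I_d).
  by rewrite -psumr_eq0 -/S ?S0 ?eqxx // => l _; exact: sqr_ge0.
by rewrite mem_index_enum ki sqrf_eq0 subr_eq0 => /(_ isT) /eqP.
Qed.

Variable b : nat.
Local Notation vertex := (tile b * nat)%type.
Implicit Types (x y : vertex) (i : 'I_b) (k : 'I_b.+1).

Definition side j : R := (3 ^ j)%:R^-1.

Lemma side_gt0 j : 0 < side j.
Proof. by rewrite invr_gt0 ltr0n expn_gt0. Qed.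

Lemma sideS j : side j = 3 * side j.+1.
Proof. by rewrite /side expnS natrM invfM mulrA divff ?mul1r // pnatr_eq0. Qed.

Lemma ler_side j j' a a' :
  (side j * a%:R <= side j' * a'%:R) = (a * 3 ^ j' <= a' * 3 ^ j)%N.
Proof.
rewrite /side ler_pdivrMl ?ltr0n ?expn_gt0 // mulrCA.
by rewrite ler_pdivlMl ?ltr0n ?expn_gt0 // -!natrM ler_nat mulnC [leqRHS]mulnC.
Qed.

Lemma side_le3 j l : (j <= l.+1)%N -> side l <= 3 * side j.
Proof.
move=> jl; rewrite /side ler_pdivlMr ?ltr0n ?expn_gt0 //.
by rewrite mulrC ler_pdivrMr ?ltr0n ?expn_gt0 // -natrM ler_nat -expnS leq_exp2l.
Qed.

Lemma side_anti j l : (j <= l)%N -> side l <= side j.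
Proof.
move=> jl; have := ler_side l j 1 1; rewrite !mulr1 !mul1n => ->.
by rewrite leq_exp2l.
Qed.

(** The coordinate 0 is the vertical one, along the columns. *)
Definition crd x k : nat := if unlift ord0 k is Some i then x.1.2 i else x.2.

Lemma crd0 x : crd x ord0 = x.2.
Proof. by rewrite /crd unlift_none. Qed.

Lemma crd_lift x i : crd x (lift ord0 i) = x.1.2 i.
Proof. by rewrite /crd liftK. Qed.

Definition cube_center x : 'rV[R]_b.+1 := \row_k (side x.1.1 * ((crd x k)%:R + 2^-1)).

Definition cube_radius x : R := side x.1.1 / 2.

Lemma cube_radius_gt0 x : 0 < cube_radius x.
Proof. by rewrite divr_gt0 ?side_gt0. Qed.

Lemma tangent_touch x y k :
  tangent (cube_center x) (cube_radius x) (cube_center y) (cube_radius y) ->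
  side x.1.1 * (crd x k)%:R <= side y.1.1 * (crd y k).+1%:R.
Proof.
move=> [p pxy]; have [/= px py] : (esphere (cube_center x) (cube_radius x) `&`
  esphere (cube_center y) (cube_radius y))%classic p by rewrite pxy.
have := edist_coord (cube_center x) p k; have := edist_coord (cube_center y) p k.
rewrite px py !mxE /cube_radius !ler_norml -[(crd y k).+1%:R]natr1.
move=> /andP[h1 h2] /andP[h3 h4].
by lra.
Qed.

Lemma below_disjoint x y k :
  side x.1.1 * (crd x k).+1%:R <= side y.1.1 * (crd y k)%:R ->
  (open_eball (cube_center x) (cube_radius x) `&`
   open_eball (cube_center y) (cube_radius y) = set0)%classic.
Proof.
move=> h; apply/seteqP; split=> // p [/= px py]; exfalso.
have := le_lt_trans (edist_coord (cube_center x) p k) px.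
have := le_lt_trans (edist_coord (cube_center y) p k) py.
move: h; rewrite !mxE /cube_radius !ltr_norml -[(crd x k).+1%:R]natr1.
move=> h /andP[h1 h2] /andP[h3 h4].
by lra.
Qed.

Lemma hop_tangent x y : hop x y ->
  tangent (cube_center x) (cube_radius x) (cube_center y) (cube_radius y).
Proof.
case=> [xy z|i e z v|i e z vi vk].
- apply: (@tangent_axis _ _ _ _ _ ord0); rewrite ?cube_radius_gt0 //.
    move=> k; case: (unliftP ord0 k) => [j ->|->//] _.
    by rewrite !mxE !crd_lift -xy.
  by rewrite !mxE !crd0 z /cube_radius -xy -[x.2.+1%:R]natr1; lra.
- apply: (@tangent_axis _ _ _ _ _ (lift ord0 i)); rewrite ?cube_radius_gt0 //.
    move=> k; case: (unliftP ord0 k) => [j ->|->] ki; rewrite !mxE -e.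
      rewrite !crd_lift v (_ : (j == i) = false) ?addn0 //.
      by apply: contraNF ki => /eqP ->.
    by rewrite !crd0 z.
  by rewrite !mxE !crd_lift v eqxx addn1 /cube_radius -e -[(x.1.2 i).+1%:R]natr1; lra.
- apply: (@tangent_axis _ _ _ _ _ (lift ord0 i)); rewrite ?cube_radius_gt0 //.
    move=> k; case: (unliftP ord0 k) => [j ->|->] ki; rewrite !mxE e (sideS x.1.1).
      rewrite !crd_lift vk; last by apply: contraNneq ki => ->.
      by rewrite -[(3 * _).+1%:R]natr1 natrM; lra.
    by rewrite !crd0 z -[(3 * _).+1%:R]natr1 natrM; lra.
  rewrite !mxE !crd_lift vi /cube_radius e (sideS x.1.1) natrM.
  by rewrite -[(x.1.2 i).+1%:R]natr1; lra.
Qed.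

Lemma hop_neq x y : hop x y -> x <> y.
Proof.
case=> [_ + e|i _ _ + e|i + _ _ _ e]; rewrite e; try lia.
by move/(_ i); rewrite eqxx; lia.
Qed.

End Spheres.

(** * Distances in a graph *)

Section GraphDistance.
Local Open Scope nat_scope.
Variable G : graph.
Implicit Types (x y : G).

Lemma gdist_le x p : path (@adj G) x p -> gdist x (last x p) <= size p.
Proof.
move=> xp; rewrite /gdist; case: ex_minnP => n _; apply.
by apply/asboolP; exists p.
Qed.

Lemma gdist_walk x y :
  exists p, [/\ size p = gdist x y, path (@adj G) x p & last x p = y].
Proof. by rewrite /gdist; case: ex_minnP => n /asboolP. Qed.

Lemma gdist_adj x y z : adj y z -> gdist x z <= (gdist x y).+1.
Proof.
move=> yz; have [p [<- xp py]] := gdist_walk x y.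
have := @gdist_le x (rcons p z).
by rewrite size_rcons last_rcons rcons_path py xp yz; apply.
Qed.

(** Distances change by at most one along an edge, so a ray hits each sphere that
    it crosses: take its first point at distance at least r, and after it the first
    one at distance at least r'. *)
Lemma ray_path x r r' (c : nat -> G) : r < r' -> gdist x (c 0) <= r ->
  (forall n, adj (c n) (c n.+1)) -> injective c -> (exists n, r' <= gdist x (c n)) ->
  exists s, path_between (gsphere x r) (gsphere x r') s /\
            forall y, y \in s -> exists n, y = c n.
Proof.
move=> rr' c0 cadj cinj [N N1].
have ex1 : exists n, r <= gdist x (c n) by exists N; lia.
case: (ex_minnP ex1) => n1 n1r n1min.
have ex2 : exists n, r' <= gdist x (c (n1 + n)).
  exists (N - n1); rewrite subnKC //; apply: n1min; lia.
case: (ex_minnP ex2) => n2 n2r n2min.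
have e1 : gdist x (c n1) = r.
  case: n1 n1r n1min {ex2 n2r n2min} => [|n] h hmin; first lia.
  have := gdist_adj x (cadj n); have := hmin n; lia.
have e2 : gdist x (c (n1 + n2)) = r'.
  case: n2 n2r n2min => [|n] h hmin; first by rewrite addn0 in h; lia.
  rewrite addnS in h *; have := gdist_adj x (cadj (n1 + n)); have := hmin n; lia.
exists [seq c k | k <- iota n1 n2.+1]; split; last first.
  by move=> y /mapP[k _ ->]; exists k.
exists (c n1), [seq c k | k <- iota n1.+1 n2]; split=> //=.
- by elim: (n2) (n1) => //= n IH k; rewrite cadj IH.
- by rewrite (map_inj_uniq cinj) (iota_uniq n1.+1) andbT; apply/mapP=> -[k];
    rewrite mem_iota => kk /cinj e; lia.
- have -> : last (c n1) [seq c k | k <- iota n1.+1 n2] = c (n1 + n2); last by [].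
  by rewrite last_map; congr c; elim: (n2) (n1) => [|n IH] k;
     rewrite ?addn0 //= IH addSnnS.
Qed.

End GraphDistance.

(** * The tangency graph *)

Section SphereGraph.
Local Open Scope nat_scope.
Variables (R : realType) (b m : nat).
Hypothesis m_ge4 : 4 <= m.
Hypothesis m_mod3 : m %% 3 = 1.
Hypothesis b_ge2 : 2 <= b.
Local Notation raw := (tile b * nat)%type.
Local Notation in_tiling := (@in_tiling b m).
Local Notation tiling := (@tiling b m).

Definition is_vertex (x : raw) := `[< in_tiling x.1 >].

Definition cube := {x : raw | is_vertex x}.

Definition cube_tangent (x y : raw) :=
  tangent (cube_center R x) (cube_radius R x) (cube_center R y) (cube_radius R y).

Definition cube_adj (x y : cube) := `[< x <> y /\ cube_tangent (val x) (val y) >].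

Lemma cube_adj_sym : symmetric cube_adj.
Proof.
by move=> x y; apply/asboolP/asboolP => -[xy t]; split; [exact: nesym|exact: tangentC|
  exact: nesym|exact: tangentC].
Qed.

Lemma cube_adj_irr : irreflexive cube_adj.
Proof. by move=> x; apply/asboolP => -[]. Qed.

Lemma in_tiling2 f g : in_tiling f -> in_tiling g ->
  exists n, f \in tiling n /\ g \in tiling n.
Proof.
have b0 := ltnW b_ge2; move=> [n fn] [k gk]; exists (n + k); split.
  exact: (tiling_mono m_ge4 b0 (leq_addr _ _)) fn.
exact: (tiling_mono m_ge4 b0 (leq_addl _ _)) gk.
Qed.

Lemma cubes_disjoint (x y : cube) : x <> y ->
  (open_eball (cube_center R (val x)) (cube_radius R (val x)) `&`
   open_eball (cube_center R (val y)) (cube_radius R (val y)) = set0)%classic.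
Proof.
case: x y => [[f z] fP] [[g w] gP] ne.
have [fg|/eqP fg] := eqVneq f g.
  have zw : z != w.
    by apply: contra_notN ne => /eqP zw; apply/val_inj; rewrite /= fg zw.
  move: zw; rewrite neq_ltn => /orP[] zw.
    apply: (below_disjoint (k := ord0)).
    by rewrite ler_side !crd0 /= fg leq_pmul2r ?expn_gt0.
  rewrite setIC; apply: (below_disjoint (k := ord0)).
  by rewrite ler_side !crd0 /= fg leq_pmul2r ?expn_gt0.
have [n [fn gn]] := in_tiling2 (asboolW fP) (asboolW gP).
have [i [] h] := tiling_below m_ge4 fn gn fg.
  by apply: (below_disjoint (k := lift ord0 i)); rewrite ler_side !crd_lift.
rewrite setIC; apply: (below_disjoint (k := lift ord0 i)).
by rewrite ler_side !crd_lift.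
Qed.

Lemma reach_path l (x : cube) (y : raw) : reach m l (val x) y ->
  exists p, [/\ path cube_adj x p, val (last x p) = y & size p <= l].
Proof.
move e : (val x) => x0 r; elim: r x e => [l1 x1|l1 x1 y1 z1 xH yH xy r IH] x e.
  by exists [::].
have yP : is_vertex y1 by apply/asboolP.
have [p [yp py ps]] := IH (Sub y1 yP) (SubK _ _).
exists (Sub y1 yP :: p); split=> //=; rewrite yp andbT; apply/asboolP.
have ev : val (Sub y1 yP : cube) = y1 by exact: SubK.
split=> [xe|].
  by move: e; rewrite xe ev => e; case: xy => /hop_neq; apply; rewrite e.
rewrite /cube_tangent ev e; case: xy => h; first exact: hop_tangent.
exact/tangentC/hop_tangent.
Qed.

(** The cell d of the level-n block c, a block being named by the cube that it
    is the magnification of. *)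
Definition vplace n (c d : raw) : raw :=
  (place m n c.1 d.1, d.2 + 3 ^ d.1.1 * m ^ n * c.2).

Definition block n : seq raw :=
  [seq (f, w) | f <- tiling n, w <- iota 0 (3 ^ f.1 * m ^ n)].

Lemma mem_block n (d : raw) :
  (d \in block n) = (d.1 \in tiling n) && (d.2 < 3 ^ d.1.1 * m ^ n).
Proof.
apply/allpairsPdep/andP => [[f [w [fn wn ->]]]|[fn wn]] /=.
  by move: wn; rewrite mem_iota.
by exists d.1, d.2; rewrite mem_iota -surjective_pairing.
Qed.

Lemma size_block n : size (block n) = (m * (m ^ b - 1 + 3 * 3 ^ b)) ^ n.
Proof.
rewrite size_allpairs_dep -sum_tiling // sumnE big_map.
by apply: eq_bigr => f _; rewrite size_iota.
Qed.

Lemma block_uniq n : uniq (block n).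
Proof.
apply: allpairs_uniq_dep; first exact: tiling_uniq.
  by move=> f _; exact: iota_uniq.
by move=> [f1 w1] [f2 w2] /= _ _ [-> ->].
Qed.

Lemma crd_block n d k : d \in block n -> crd d k < 3 ^ d.1.1 * m ^ n.
Proof.
rewrite mem_block => /andP[dn wn].
by case: (unliftP ord0 k) => [j ->|->]; rewrite ?crd0 ?crd_lift // tiling_lt.
Qed.

Lemma crd_vplace n c d k :
  crd (vplace n c d) k = crd d k + 3 ^ d.1.1 * m ^ n * crd c k.
Proof.
by case: (unliftP ord0 k) => [j ->|->]; rewrite ?crd0 ?crd_lift ?ffunE.
Qed.

Lemma vplace_inj n c : injective (vplace n c).
Proof.
move=> [[e v] w] [[e' v'] w'] /= [/addnI <- /ffunP ev /addIn <-].
congr (_, _, _); apply/ffunP=> i; have := ev i; rewrite !ffunE /=.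
by move/addIn.
Qed.

Lemma vplace_vertex n c d : is_vertex c -> d \in block n -> is_vertex (vplace n c d).
Proof.
move=> /asboolP cH; rewrite mem_block => /andP[dn _]; apply/asboolP.
exact: in_tiling_place.
Qed.

Lemma vertex_block n x : is_vertex x ->
  exists c d, [/\ is_vertex c, d \in block n & x = vplace n c d].
Proof.
case: x => f z /asboolP[/= k fk].
have b0 := ltnW b_ge2.
have /tilingD[g [h [gk hn ->]]] := tiling_mono m_ge4 b0 (leq_addl n k) fk.
have H0 : 0 < 3 ^ h.1 * m ^ n by rewrite muln_gt0 expn_gt0 expm_gt0.
exists (g, z %/ (3 ^ h.1 * m ^ n)), (h, z %% (3 ^ h.1 * m ^ n)); split.
- by apply/asboolP; exists k.
- by rewrite mem_block hn ltn_mod.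
- by congr pair; rewrite /= addnC mulnC -divn_eq.
Qed.

Lemma cube_origin : is_vertex ((0, [ffun=> 0]), 0).
Proof. by apply/asboolP; exists 0; rewrite inE. Qed.

Lemma block_reach n c d d' : is_vertex c -> d \in block n -> d' \in block n ->
  reach m (2 * block_radius b m * (m ^ n).-1) (vplace n c d) (vplace n c d').
Proof.
move=> /asboolP cH; rewrite !mem_block => /andP[dn wn] /andP[dn' wn'].
have r := reach_block m_ge4 m_mod3 b_ge2 c.2 cH dn wn.
have r' := reach_block m_ge4 m_mod3 b_ge2 c.2 cH dn' wn'.
by apply: reach_le (reach_trans r (reach_sym r')) _; lia.
Qed.

Lemma cube_connected (x y : cube) :
  exists2 p, path cube_adj x p & last x p = y.
Proof.
case: x y => [[f z] fP] [[g w] gP].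
have [n [fn gn]] := in_tiling2 (asboolW fP) (asboolW gP).
have m1 : 1 < m by lia.
have z1 : z < m ^ (z + w).
  exact: leq_trans (ltn_expl z m1) (leq_pexp2l (ltnW m1) (leq_addr _ _)).
have w1 : w < m ^ (z + w).
  exact: leq_trans (ltn_expl w m1) (leq_pexp2l (ltnW m1) (leq_addl _ _)).
pose l := n + (z + w).
have M1 k : m ^ (z + w) <= 3 ^ k * m ^ l.
  by rewrite -[leqLHS]mul1n leq_mul ?expn_gt0 // (leq_pexp2l (ltnW m1)) ?leq_addl.
have b0 := ltnW b_ge2.
have dx : (f, z) \in block l.
  rewrite mem_block (tiling_mono m_ge4 b0 (leq_addr _ _) fn) /=.
  exact: leq_trans z1 (M1 _).
have dy : (g, w) \in block l.
  rewrite mem_block (tiling_mono m_ge4 b0 (leq_addr _ _) gn) /=.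
  exact: leq_trans w1 (M1 _).
have E d : vplace l ((0, [ffun=> 0]), 0) d = d.
  case: d => [[e v] u]; rewrite /vplace /place /= add0n muln0 addn0.
  by congr (_, _, _); apply/ffunP=> i; rewrite !ffunE muln0 addn0.
have := block_reach cube_origin dx dy; rewrite !E => r.
have [p [xp py _]] := @reach_path _ (Sub (f, z) fP) _ r.
by exists p => //; apply: val_inj.
Qed.

Definition sphere_graph : graph :=
  @Graph cube cube_adj cube_adj_sym cube_adj_irr
    (inhabits (Sub _ cube_origin)) cube_connected.

Lemma sphere_graph_packed : uniformly_sphere_packed R b.+1 sphere_graph.
Proof.
exists 3%R, (fun x : cube => cube_center R (val x)).
exists (fun x : cube => cube_radius R (val x)).
split; first split.
- by move=> x; exact: cube_radius_gt0.
- exact: cubes_disjoint.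
- by move=> x y; split => [/asboolP|h]; [|exact/asboolP].
move=> x y t.
have nr : tile_near (val x).1 (val y).1.
  move=> i; have := tangent_touch (lift ord0 i) t.
  have := tangent_touch (lift ord0 i) (tangentC t).
  rewrite !ler_side !crd_lift => h1 h2.
  have X0 : 0 < 3 ^ (val x).1.1 by rewrite expn_gt0.
  have Y0 : 0 < 3 ^ (val y).1.1 by rewrite expn_gt0.
  move: h1 h2 X0 Y0.
  move: (3 ^ (val x).1.1) (3 ^ (val y).1.1) ((val x).1.2 i) ((val y).1.2 i).
  by move=> X Y a a' h1 h2 X0 Y0; split; lia.
have [n [xn yn]] := in_tiling2 (asboolW (valP x)) (asboolW (valP y)).
have [h1 h2] := tile_near_scale m_ge4 xn yn nr.
apply/andP; split.
  rewrite ler_pdivlMr ?cube_radius_gt0 // mulrC ler_pdivrMr // /cube_radius.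
  by have := side_le3 R h1; lra.
by rewrite ler_pdivrMr ?cube_radius_gt0 // /cube_radius; have := side_le3 R h2; lra.
Qed.

End SphereGraph.

(** * Balls and columns *)

Section BallBounds.
Local Open Scope nat_scope.
Variables (R : realType) (b m : nat).
Hypothesis m_ge4 : 4 <= m.
Hypothesis m_mod3 : m %% 3 = 1.
Hypothesis b_ge2 : 2 <= b.
Local Notation raw := (tile b * nat)%type.
Local Notation G := (sphere_graph R m_ge4 m_mod3 b_ge2).
Local Notation vplace := (@vplace b m).
Local Notation block := (@block b m).
Local Notation volume := (m * (m ^ b - 1 + 3 * 3 ^ b)).
Implicit Types (c d : raw) (k : 'I_b.+1).

Lemma vplace_low n c d k : d \in block n ->
  (side R c.1.1 * (m ^ n * crd c k)%:R <=
   side R (vplace n c d).1.1 * (crd (vplace n c d) k)%:R)%R.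
Proof.
move=> dn; rewrite ler_side crd_vplace /= expnD.
by move: (3 ^ _) (3 ^ _) (m ^ n) => E J M; nia.
Qed.

Lemma vplace_high n c d k : d \in block n ->
  (side R (vplace n c d).1.1 * (crd (vplace n c d) k).+1%:R <=
   side R c.1.1 * (m ^ n * (crd c k).+1)%:R)%R.
Proof.
move=> dn; rewrite ler_side crd_vplace /= expnD.
have := crd_block m_ge4 k dn.
move: (crd d k) (crd c k) (3 ^ c.1.1) (3 ^ d.1.1) (m ^ n) => a a' E J M lt.
have : (a + J * M * a').+1 <= J * M * a'.+1 by nia.
by move=> /leq_mul/(_ (leqnn E)); nia.
Qed.

Definition cube_near c d := forall k,
  3 * crd c k * 3 ^ d.1.1 < 3 * (crd d k).+1 * 3 ^ c.1.1 + 3 ^ d.1.1 /\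
  3 * crd d k * 3 ^ c.1.1 < 3 * (crd c k).+1 * 3 ^ d.1.1 + 3 ^ d.1.1.

Lemma cube_near_scale c d : is_vertex m c -> is_vertex m d -> cube_near c d ->
  c.1.1 <= d.1.1.+1 /\ d.1.1 <= c.1.1.+1.
Proof.
move=> /asboolP cH /asboolP dH nr; have [n [cn dn]] := in_tiling2 m_ge4 b_ge2 cH dH.
apply: (tile_near_scale m_ge4 cn dn) => i.
by have := nr (lift ord0 i); rewrite !crd_lift.
Qed.

(** The cube y comes within 3 l times the side of the tile c.1 of the level-n block
    c: cubes near the block have at most three times that side, so
    this is how far l steps can lead. *)
Definition halo n c (l : nat) (y : raw) := forall k,
  (side R y.1.1 * (crd y k)%:R <=
     side R c.1.1 * ((m ^ n * (crd c k).+1)%:R + 3 * l%:R))%R /\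
  (side R c.1.1 * ((m ^ n * crd c k)%:R - 3 * l%:R) <=
     side R y.1.1 * (crd y k).+1%:R)%R.

(** For 9 l < m^n the halo is thinner than a third of the side of the block. *)
Lemma halo_near n c l c' d : 9 * l < m ^ n -> d \in block n ->
  halo n c l (vplace n c' d) -> cube_near c c'.
Proof.
move=> lm dn hl k; have [h1 h2] := hl k.
have s0 := side_gt0 R c.1.1.
have M0 : (0 < (m ^ n)%:R :> R)%R by rewrite ltr0n expm_gt0.
have lM : (9 * l%:R < (m ^ n)%:R :> R)%R by rewrite -natrM ltr_nat.
have := le_trans (vplace_low c' k dn) h1; have := le_trans h2 (vplace_high c' k dn).
rewrite !natrM => h4 h3; clear h1 h2.
have slM : (side R c.1.1 * (9 * l%:R) < side R c.1.1 * (m ^ n)%:R)%R.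
  by rewrite ltr_pM2l.
have {h3} h3 : (side R c'.1.1 * (3 * crd c' k)%:R <
    side R c.1.1 * (3 * crd c k + 4)%:R)%R.
  rewrite -(ltr_pM2l M0) natrD !natrM; rewrite -[(crd c k).+1%:R%R]natr1 in h3; nra.
have {h4} h4 : (side R c.1.1 * (3 * crd c k)%:R <
    side R c'.1.1 * (3 * (crd c' k).+1)%:R + side R c.1.1)%R.
  by rewrite -(ltr_pM2l M0) !natrM; nra.
split; last first.
  move: h3; rewrite ltNge ler_side -ltnNge.
  by move: (3 ^ _) (3 ^ _) => E E'; lia.
rewrite ltnNge; apply/negP => h.
have : (3 * (crd c' k).+1) * 3 ^ c.1.1 <= (3 * crd c k).-1 * 3 ^ c'.1.1.
  have : 0 < 3 ^ c'.1.1 by rewrite expn_gt0.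
  have : 0 < 3 ^ c.1.1 by rewrite expn_gt0.
  by move: h; move: (3 ^ _) (3 ^ _) => E E' h E0 E0'; case: (crd c k) h => [|a]; nia.
rewrite -(ler_side R) => h'; have := lt_le_trans h4 (lerD h' (lexx _)).
case: (crd c k) h => [|a] h.
  have : 0 < 3 ^ c'.1.1 by rewrite expn_gt0.
  by move: h; rewrite muln0 mul0n leqn0 addn_eq0 => /andP[_ /eqP ->].
have -> : ((3 * a.+1)%:R = ((3 * a.+1).-1)%:R + 1 :> R)%R.
  by rewrite natr1 prednK // muln_gt0.
by rewrite mulrDr mulr1 ltxx.
Qed.

(** As long as the walk stays in a near block, the cube y has at most three
    times the side of c.1, so one step widens the halo by at most that much. *)
Lemma halo_step n c l c' d y' : is_vertex m c -> is_vertex m c' ->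
  9 * l < m ^ n -> d \in block n -> halo n c l (vplace n c' d) ->
  cube_tangent R (vplace n c' d) y' -> halo n c l.+1 y'.
Proof.
move=> cP cP' lm dn hl t.
have [j1 j2] := cube_near_scale cP cP' (halo_near lm dn hl).
have sy : (side R (vplace n c' d).1.1 <= 3 * side R c.1.1)%R.
  by apply: le_trans (side_anti R (leq_addr _ _)) (side_le3 R j1).
move=> k; have [h1 h2] := hl k; have := tangent_touch k t.
have := tangent_touch k (tangentC t); rewrite -!(natr1 (crd _ k)) -(natr1 l).
by move: h1 h2; rewrite -[(crd (vplace n c' d) k).+1%:R%R]natr1; split; lra.
Qed.

Lemma walk_halo n c d (x : G) p : val x = vplace n c d -> is_vertex m c ->
  d \in block n -> path (@adj G) x p -> 9 * size p < m ^ n ->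
  halo n c (size p) (val (last x p)).
Proof.
move=> xE cP dn; elim/last_ind: p => [_ _|p z IH].
  move=> k /=; rewrite xE mulr0 addr0 subr0; split.
    apply: le_trans (vplace_high c k dn).
    by rewrite ler_wpM2l ?ler_nat // ltW ?side_gt0.
  apply: le_trans (vplace_low c k dn) _.
  by rewrite ler_wpM2l ?ler_nat // ltW ?side_gt0.
rewrite rcons_path size_rcons last_rcons => /andP[xp /asboolP[_ t]] lm.
have lm' : 9 * size p < m ^ n by lia.
have [c' [d' [cP' dn' e]]] := vertex_block m_ge4 b_ge2 n (valP (last x p)).
by move: (IH xp lm') t; rewrite e => h; apply: halo_step h.
Qed.

(** A lower bound for the coordinate, in units of 3^-e', of a cube near a cube whose
    coordinate is a in units of 3^-e. *)
Definition window e (e' a : nat) := a * 3 ^ e' %/ 3 ^ e - 1.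

Lemma mem_window e e' a a' : e' <= e.+1 ->
  3 * a * 3 ^ e' < 3 * a'.+1 * 3 ^ e + 3 ^ e' ->
  3 * a' * 3 ^ e < 3 * a.+1 * 3 ^ e' + 3 ^ e' ->
  window e e' a <= a' < window e e' a + 8.
Proof.
move=> ee; rewrite /window.
have : 3 ^ e' <= 3 * 3 ^ e by rewrite -expnS leq_exp2l.
have : 0 < 3 ^ e by rewrite expn_gt0.
move: (3 ^ e) (3 ^ e') => E E' E0 EE.
have := divn_eq (a * E') E; have := ltn_pmod (a * E') E0.
move: (_ %/ _) (_ %% _) => q r rE qE h1 h2.
have : q < a'.+2 by rewrite -(ltn_pmul2r E0); nia.
have : a' < q + 5 by rewrite -(ltn_pmul2r E0); nia.
by lia.
Qed.

Definition neighbours c : seq raw :=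
  [seq (let e := c.1.1 + u - 1 in
        ((e, [ffun i => window c.1.1 e (c.1.2 i) + h (lift ord0 i)]),
         window c.1.1 e c.2 + h ord0)) |
     u <- iota 0 3, h : {ffun 'I_b.+1 -> 'I_8} <- enum predT].

Lemma size_neighbours c : size (neighbours c) = 3 * 8 ^ b.+1.
Proof. by rewrite size_allpairs size_iota -cardE card_ffun !card_ord. Qed.

(** A near cube is determined by its scale, within 1 of that of c, and by its offsets
    in windows of length 8. *)
Lemma mem_neighbours c c' : is_vertex m c -> is_vertex m c' -> cube_near c c' ->
  c' \in neighbours c.
Proof.
move=> cP cP' nr; have [e1 e2] := cube_near_scale cP cP' nr.
have wP k : crd c' k - window c.1.1 c'.1.1 (crd c k) < 8.
  have [h1 h2] := nr k; have /andP[] := mem_window e2 h1 h2.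
  by move: (window _ _ _) => w; lia.
apply/allpairsP; exists (c'.1.1.+1 - c.1.1, [ffun k => Ordinal (wP k)]); split=> /=.
- by rewrite !inE; lia.
- by rewrite mem_enum.
- have -> : c.1.1 + (c'.1.1.+1 - c.1.1) - 1 = c'.1.1 by lia.
  have le k : window c.1.1 c'.1.1 (crd c k) <= crd c' k.
    by have [h1 h2] := nr k; have /andP[] := mem_window e2 h1 h2.
  rewrite [LHS]surjective_pairing [c'.1 in LHS]surjective_pairing.
  congr (_, _, _).
    apply/ffunP=> i; rewrite !ffunE /= !crd_lift subnKC //.
    by have := le (lift ord0 i); rewrite !crd_lift.
  by rewrite ffunE /= !crd0 subnKC //; have := le ord0; rewrite !crd0.
Qed.

Lemma ball_sub n t (x : G) : 9 * t < m ^ n ->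
  exists s : seq G, size s <= 3 * 8 ^ b.+1 * volume ^ n /\
    forall y, gdist x y <= t -> y \in s.
Proof.
move=> tm; have [c [d [cP dn e]]] := vertex_block m_ge4 b_ge2 n (valP x).
exists (pmap insub [seq vplace n c' d' | c' <- neighbours c, d' <- block n]).
split.
  rewrite size_pmap; apply: leq_trans (count_size _ _) _.
  by rewrite size_allpairs size_neighbours size_block.
move=> y yt; have [p [ps xp py]] := gdist_walk x y.
have pm : 9 * size p < m ^ n by rewrite ps; lia.
have hl := walk_halo e cP dn xp pm; rewrite py in hl.
have [c' [d' [cP' dn' e']]] := vertex_block m_ge4 b_ge2 n (valP y).
rewrite e' in hl; rewrite mem_pmap_sub e'.
apply: allpairs_f => //; apply: mem_neighbours => //.
exact: halo_near pm dn' hl.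
Qed.

Lemma block_gdist n c d d' (x y : G) : is_vertex m c -> d \in block n ->
  d' \in block n -> val x = vplace n c d -> val y = vplace n c d' ->
  gdist x y <= 2 * block_radius b m * (m ^ n).-1.
Proof.
move=> cP dn dn' xE yE.
have := block_reach m_ge4 m_mod3 b_ge2 cP dn dn'; rewrite -xE -yE.
move=> /(@reach_path R)[p [xp /val_inj py ps]].
by apply: leq_trans ps; rewrite -py; exact: (@gdist_le G).
Qed.

Lemma sub_ball n (x : G) : exists s : seq G,
  [/\ uniq s, size s = volume ^ n &
      forall y, y \in s -> gdist x y <= 2 * block_radius b m * (m ^ n).-1].
Proof.
have [c [d [cP dn e]]] := vertex_block m_ge4 b_ge2 n (valP x).
have vP y : y \in [seq vplace n c d' | d' <- block n] -> is_vertex m y.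
  by move=> /mapP[d' d'n ->]; exact: vplace_vertex.
exists (pmap insub [seq vplace n c d' | d' <- block n]); split.
- apply: pmap_sub_uniq; rewrite map_inj_uniq ?block_uniq //; exact: vplace_inj.
- rewrite size_pmap_sub -(size_block b m_ge4) -(size_map (vplace n c)).
  by apply/eqP; rewrite -all_count; apply/allP.
- move=> y; rewrite mem_pmap_sub => /mapP[d' d'n e'].
  exact: block_gdist cP dn d'n e e'.
Qed.

(** The columns over the base tiles of the block of x.  Each one starts close to
    x, and it leaves every ball because balls are finite. *)
Lemma columns n r r' (x : G) : 2 * block_radius b m * (m ^ n).-1 <= r -> r < r' ->
  exists P : 'I_(size (tiling b m n)) -> seq G,
    disjoint_paths (gsphere x r) (gsphere x r') P.
Proof.
move=> nr rr'; have [c [d [cP dn e]]] := vertex_block m_ge4 b_ge2 n (valP x).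
pose tl (i : 'I_(size (tiling b m n))) := nth (0, [ffun=> 0]) (tiling b m n) i.
have tln i : tl i \in tiling b m n by exact: mem_nth.
have tl0 i : (tl i, 0) \in block n.
  by rewrite mem_block tln muln_gt0 expn_gt0 expm_gt0.
have vP i (k : nat) : is_vertex m (place m n c.1 (tl i), (vplace n c (tl i, 0)).2 + k).
  exact: vplace_vertex cP (tl0 i).
pose col i (k : nat) : G :=
  Sub (place m n c.1 (tl i), (vplace n c (tl i, 0)).2 + k) (vP i k).
have colE i (k : nat) :
    val (col i k) = (place m n c.1 (tl i), (vplace n c (tl i, 0)).2 + k).
  exact: SubK.
have col_inj i (k : nat) i' (k' : nat) : col i k = col i' k' -> i = i' /\ k = k'.
  move=> /(congr1 val); rewrite !colE => -[h1 h2 h3].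
  have tt : tl i = tl i'.
    have := @vplace_inj b m n c (tl i, 0) (tl i', 0); rewrite /vplace /=.
    have <- : (tl i).1 = (tl i').1 by move: h1 => /addnI.
    by rewrite {2}/place /= -h1 -h2 => /(_ erefl)[].
  have ii' : i = i'.
    apply/val_inj/eqP.
    have un := tiling_uniq b m_ge4 n.
    rewrite -(nth_uniq (0, [ffun=> 0]) (ltn_ord i) (ltn_ord i') un).
    exact/eqP.
  by split=> //; move: h3; rewrite ii' => /addnI.
have colr i : gdist x (col i 0) <= r.
  apply: leq_trans nr; apply: block_gdist cP dn (tl0 i) e _.
  by rewrite colE addn0.
have coladj i (k : nat) : adj (col i k) (col i k.+1).
  apply/asboolP; split; first by move=> /col_inj[_]; lia.
  rewrite /cube_tangent !colE; apply: hop_tangent; apply: HopUp => //=.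
  by rewrite addnS.
have colinj i : injective (col i) by move=> p q /col_inj[].
have colfar i : exists k : nat, r' <= gdist x (col i k).
  have r'm : 9 * r' < m ^ (9 * r') by apply: ltn_expl; lia.
  have [s [_ sP]] := ball_sub x r'm.
  apply: contrapT => /forallNP far.
  have := @uniq_leq_size _ [seq col i q | q <- iota 0 (size s).+1] s.
  rewrite map_inj_uniq // iota_uniq size_map size_iota ltnn => h.
  suff: false by []. apply: h => // y /mapP[k _ ->]; apply: sP.
  by apply: ltnW; rewrite ltnNge; apply/negP/far.
have /choice[P PP] i := ray_path rr' (colr i) (coladj i) (colinj i) (colfar i).
exists P; split; first by move=> i; have [] := PP i.
apply/trivIsetP => i j _ _ ij; apply/seteqP; split=> // y [/= yi yj].
have [_ /(_ y yi)[k yk]] := PP i; have [_ /(_ y yj)[l yl]] := PP j.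
by case/negP: ij; apply/eqP; have [] : i = j /\ k = l by apply: col_inj; rewrite -yk.
Qed.

End BallBounds.

Local Open Scope classical_set_scope.
Local Open Scope ring_scope.

(** * Exponents *)

Section Growth.
Variable R : realType.

Definition log_base (m N : nat) : R := ln N%:R / ln m%:R.

Variable m : nat.
Hypothesis m_gt1 : (1 < m)%N.

Lemma ln_base_gt0 : 0 < ln (m%:R : R).
Proof. by rewrite ln_gt0 // ltr1n. Qed.

Lemma powR_log_base N n : (0 < N)%N -> (m ^ n)%:R `^ log_base m N = (N ^ n)%:R :> R.
Proof.
move=> N0; have m0 : (0 < m%:R :> R) by rewrite ltr0n ltnW.
have N0' : 0 < N%:R :> R by rewrite ltr0n.
rewrite natrX -powR_mulrn ?ltW // -powRrM mulrC powRrM.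
have -> : m%:R `^ log_base m N = N%:R :> R.
  apply: ln_inj; rewrite ?posrE ?powR_gt0 //.
  by rewrite ln_powR /log_base divfK // gt_eqF ?ln_base_gt0.
by rewrite powR_mulrn ?ltW // natrX.
Qed.

Lemma log_base_le N x : (0 < N)%N -> N%:R <= m%:R `^ x -> log_base m N <= x.
Proof.
move=> N0 h; have m0 : (0 < m%:R :> R) by rewrite ltr0n ltnW.
rewrite ler_pdivrMr ?ln_base_gt0 // -ln_powR ler_ln ?posrE ?ltr0n //.
exact: powR_gt0.
Qed.

Lemma log_base_gt N p : (m ^ p < N)%N -> p%:R < log_base m N.
Proof.
move=> h; have m0 : (0 < m%:R :> R) by rewrite ltr0n ltnW.
rewrite ltr_pdivlMr ?ln_base_gt0 // mulr_natl -lnXn // ltr_ln ?posrE ?exprn_gt0 //.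
  by rewrite -natrX ltr_nat.
by rewrite ltr0n (leq_trans _ h).
Qed.

Lemma powR_scale N n A (x : R) : (0 < N)%N -> (0 < A)%N -> 0 <= log_base m N ->
  0 <= x -> x <= (A * m ^ n)%:R ->
  x `^ log_base m N <= A%:R `^ log_base m N * (N ^ n)%:R.
Proof.
move=> N0 A0 l0 x0 xA; rewrite -(powR_log_base n N0) -powRM ?ler0n // -natrM.
by apply: ge0_ler_powR => //; rewrite ?nnegrE ?ler0n.
Qed.

(** A radius t is matched with the largest block level whose blocks have radius at
    most t; m^n - 1 instead of m^n lets level 0 serve all small t. *)
Lemma scale_exists D t : (0 < D)%N ->
  exists n, (D * (m ^ n).-1 <= t)%N /\ (t < D * m * m ^ n)%N.
Proof.
move=> D0; exists (trunc_log m (t %/ D)); split.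
  have [->|q0] := posnP (t %/ D); first by rewrite trunc_log0 muln0.
  apply: leq_trans (leq_trunc_div t D); rewrite mulnC leq_mul2r.
  by apply/orP; right; apply: leq_trans (leq_pred _) (trunc_logP _ _).
rewrite -mulnA -expnS mulnC -ltn_divLR //.
exact: trunc_log_ltn.
Qed.

Lemma scale_exists_up t : (0 < t)%N ->
  exists n, (9 * t < m ^ n)%N /\ (m ^ n <= m * 9 * t)%N.
Proof.
move=> t0; exists (trunc_log m (9 * t)).+1; split; first exact: trunc_log_ltn.
by rewrite expnS -mulnA leq_mul2l; apply/orP; right; apply: trunc_logP => //; lia.
Qed.

End Growth.

Lemma card_fset_set_le (T : choiceType) (A : set T) (s : seq T) :
  (forall y, A y -> y \in s) -> finite_set A /\ (#|` fset_set A| <= size s)%N.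
Proof.
move=> As; have fA : finite_set A by apply: sub_finite_set (finite_seq s).
split=> //; apply: leq_trans (size_undup s); rewrite -card_fseq.
apply: fsubset_leq_card; apply/fsubsetP => y; rewrite in_fset_set // inE => /As.
by rewrite !inE.
Qed.

Lemma card_fset_set_ge (T : choiceType) (A : set T) (s : seq T) :
  finite_set A -> uniq s -> (forall y, y \in s -> A y) ->
  (size s <= #|` fset_set A|)%N.
Proof.
move=> fA su sA; rewrite -(undup_id su) -card_fseq.
apply: fsubset_leq_card; apply/fsubsetP => y; rewrite !inE => /sA Ay.
by rewrite in_fset_set // inE.
Qed.

Section Main.
Variables (R : realType) (b m : nat).
Hypothesis m_ge4 : (4 <= m)%N.
Hypothesis m_mod3 : (m %% 3 = 1)%N.
Hypothesis b_ge2 : (2 <= b)%N.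
Local Notation G := (sphere_graph R m_ge4 m_mod3 b_ge2).
Local Notation volume := (m * (m ^ b - 1 + 3 * 3 ^ b))%N.
Local Notation area := (m ^ b - 1 + 3 ^ b)%N.

Lemma m_gt1 : (1 < m)%N.
Proof. exact: leq_trans m_ge4. Qed.

Lemma block_radius_gt0 : (0 < 2 * block_radius b m)%N.
Proof. by rewrite /block_radius /block_radius1 muln_gt0 /= muln_gt0 addnS. Qed.

Lemma sphere_graph_growth : uniform_polynomial_growth G (log_base R m volume).
Proof.
set k := log_base R m volume; set D := (2 * block_radius b m)%N.
have D0 : (0 < D)%N by exact: block_radius_gt0.
have mb : (m <= m ^ b)%N.
  by rewrite -{1}[m]expn1 leq_pexp2l ?(leq_trans _ b_ge2) // (leq_trans _ m_ge4).
have b3 : (0 < 3 ^ b)%N by rewrite expn_gt0.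
have k1 : 1%:R < k by apply: log_base_gt; rewrite ?m_gt1 // expn1; nia.
have k0 : 0 <= k by apply: le_trans ler01 (ltW k1).
have V0 : (0 < volume)%N by rewrite muln_gt0 (ltnW m_gt1); lia.
split; first exact: ltW.
pose K := (3 * 8 ^ b.+1)%N.
have p1 (a : nat) : (0 < a)%N -> 1 <= a%:R `^ k :> R.
  move=> a0; apply: (@le_trans _ _ (1 `^ k)); first by rewrite powR1.
  by apply: ge0_ler_powR; rewrite ?nnegrE ?ler0n ?ler01 ?ler1n.
have Dm0 : (0 < D * m)%N by rewrite muln_gt0 D0 (ltnW m_gt1).
(* the first summand serves the lower bound, the second one the upper bound *)
exists ((D * m)%:R `^ k + K%:R * (m * 9)%:R `^ k).
  by rewrite ler_wpDr ?p1 // mulr_ge0 ?powR_ge0.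
move=> x r r1; have r0 : 0 <= r by apply: le_trans ler01 r1.
have /andP[tr rt] := truncn_itv r0; set t := Num.truncn r in tr rt.
have t0 : (0 < t)%N.
  by rewrite -ltnS -(ltr_nat R) (le_lt_trans r1).
have gt y : gball x r y -> (gdist x y <= t)%N.
  by move=> /= yr; rewrite -ltnS -(ltr_nat R) (le_lt_trans yr).
have [n [tn nt]] := scale_exists_up m_gt1 t0.
have [s [ss sP]] := ball_sub x tn.
have [fB Bs] := card_fset_set_le (fun y By => sP y (gt y By)).
split=> //.
- have [l [lt tl]] := scale_exists m_gt1 t D0.
  have [s' [su s's s'P]] := sub_ball l x.
  rewrite mulrC ler_pdivrMr; last first.
    by rewrite ltr_wpDr ?mulr_ge0 ?powR_ge0 // powR_gt0 // ltr0n.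
  have hv : (volume ^ l)%:R <= (#|` fset_set (gball x r)|)%:R :> R.
    rewrite ler_nat -s's; apply: card_fset_set_ge => // y /s'P yl /=.
    by apply: le_trans tr; rewrite ler_nat (leq_trans yl).
  apply: (@le_trans _ _ ((D * m)%:R `^ k * (volume ^ l)%:R)).
    apply: powR_scale => //; first exact: m_gt1.
    by apply: le_trans (ltW rt) _; rewrite ler_nat.
  rewrite [leRHS]mulrC; apply: ler_pM; rewrite ?powR_ge0 ?ler0n //.
  by rewrite lerDl mulr_ge0 ?powR_ge0 ?ler0n.
apply: (@le_trans _ _ (K * volume ^ n)%:R); first by rewrite ler_nat (leq_trans Bs).
rewrite natrM -(powR_log_base R m_gt1 n V0) -/k mulrDl ler_wpDl //.
  by rewrite mulr_ge0 ?powR_ge0.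
rewrite -mulrA ler_wpM2l ?ler0n // -powRM ?ler0n //; apply: ge0_ler_powR => //.
- by rewrite nnegrE.
- by rewrite nnegrE mulr_ge0.
- by apply: (@le_trans _ _ (m * 9 * t)%:R); rewrite ?ler_nat // natrM ler_wpM2l.
Qed.

Lemma sphere_graph_paths (x : G) (r r' : nat) : (1 <= r)%N -> (r < r')%N ->
  exists (n : nat) (P : 'I_n -> seq G),
    ((2 * block_radius b m * m)%:R `^ log_base R m area)^-1 *
      r%:R `^ log_base R m area <= n%:R /\
    disjoint_paths (gsphere x r) (gsphere x r') P.
Proof.
move=> r1 rr'; have [n [nr rn]] := scale_exists m_gt1 r block_radius_gt0.
have [P PP] := columns x nr rr'.
exists (size (tiling b m n)), P; split=> //.
have D0 : (0 < 2 * block_radius b m * m)%N.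
  by rewrite muln_gt0 block_radius_gt0 (ltnW m_gt1).
rewrite size_tiling // ler_pdivrMl ?powR_gt0 ?ltr0n //.
apply: powR_scale => //; first exact: m_gt1.
- by rewrite addn_gt0 expn_gt0 orbT.
- apply: le_trans (ler0n _ b) (ltW _); apply: log_base_gt; first exact: m_gt1.
  have : (3 ^ 2 <= 3 ^ b)%N by rewrite leq_exp2l.
  by have := expm_gt0 m_ge4 b; lia.
- by rewrite ler_nat ltnW.
Qed.

End Main.

Theorem theorem1p2 (R : realType) (d : nat) (hd : (3 <= d)%N)
    (eps : R) (heps : 0 < eps) :
  exists (c delta : R) (G : graph),
    [/\ 0 < c, 0 < delta,
        exists2 k : R, k <= d%:R + eps & uniform_polynomial_growth G k,
        uniformly_sphere_packed R d G &
        forall (x : G) (r r' : nat), (1 <= r)%N -> (r < r')%N ->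
          exists (n : nat) (P : 'I_n -> seq G),
            c * r%:R `^ ((d%:R - 1) + delta) <= n%:R /\
            disjoint_paths (gsphere x r) (gsphere x r') P].
Proof.
case: d hd => [//|b] b_ge2; rewrite ltnS in b_ge2.
(* m = 1 mod 3, m >= 3^(b+1) and m^eps >= 2 *)
pose m := (3 * (3 ^ b.+1 + Num.bound (2 `^ eps^-1)))%N.+1.
have m_ge4 : (4 <= m)%N.
  by rewrite /m ltnS -[3%N]/(3 * 1)%N leq_mul2l /= addn_gt0 expn_gt0.
have m_mod3 : (m %% 3 = 1)%N by rewrite /m -addn1 mulnC modnMDl.
have m1 : (1 < m)%N by exact: leq_trans m_ge4.
have mb3 : (3 ^ b.+1 <= m ^ b)%N.
  apply: (@leq_trans m); first by rewrite /m; lia.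
  by rewrite -{1}[m]expn1 leq_pexp2l // ltnW.
(* so m^b - 1 + 3^(b+1) <= 2 m^b <= m^(b+eps) *)
have m_eps : 2 <= m%:R `^ eps.
  have -> : 2 = (2 `^ eps^-1) `^ eps :> R by rewrite -powRrM mulVf ?gt_eqF // powRr1.
  apply: ge0_ler_powR; rewrite ?nnegrE ?powR_ge0 ?ler0n //; first exact: ltW.
  apply/ltW/(lt_le_trans (archi_boundP (powR_ge0 _ _))).
  by rewrite ler_nat /m; lia.
pose area := (m ^ b - 1 + 3 ^ b)%N.
have area_gt : (m ^ b < area)%N.
  have : (3 ^ 2 <= 3 ^ b)%N by rewrite leq_exp2l.
  by have := expm_gt0 m_ge4 b; rewrite /area; lia.
exists ((2 * block_radius b m * m)%:R `^ log_base R m area)^-1.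
exists (log_base R m area - b%:R).
exists (sphere_graph R m_ge4 m_mod3 b_ge2); split.
- by rewrite invr_gt0 powR_gt0 // ltr0n muln_gt0 (block_radius_gt0 b m) ltnW.
- by rewrite subr_gt0 log_base_gt.
- exists (log_base R m (m * (m ^ b - 1 + 3 * 3 ^ b))); last exact: sphere_graph_growth.
  apply: log_base_le => //; first by rewrite muln_gt0 addn_gt0 muln_gt0 expn_gt0 orbT.
  rewrite powRD; last by rewrite pnatr_eq0 implybT.
  rewrite powR_mulrn ?ler0n //.
  apply: (@le_trans _ _ ((m ^ b.+1 * 2)%:R)).
    by rewrite ler_nat expnS -mulnA leq_mul2l -[(3 * 3 ^ b)%N]expnS; lia.
  by rewrite natrM natrX ler_wpM2l ?exprn_ge0 ?ler0n.
- exact: sphere_graph_packed.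
- move=> x r r' r1 rr'.
  have -> : b.+1%:R - 1 + (log_base R m area - b%:R) = log_base R m area.
    by rewrite -natr1; ring.
  exact: sphere_graph_paths.
Qed.
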